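(* Let $T$ be a complete first-order theory, and $E$ an orbital on types, bounded, $F_\sigma$ equivalence relation on a $\lambda$-supported type-definable set $X$ (in the monster model $\mathfrak C$ of $T$). Let $Y\subseteq X$ be $E$-saturated and pseudo-closed, and assume that there is an element $a\in Y$ whose $E$-class has infinite diameter with respect to some normal form of $E$. Let $\Gamma\le \mathrm{Aut}(\mathfrak C)$ be a group witnessing that $E\restriction_{[a]_\equiv}$ is orbital. Then there is a model $M$ of size $|T|+\lambda$ and a function $\phi\colon 2^{\mathbf N}\to\mathcal P(Y_M\cap[a]_\equiv)$ which is a homeomorphic embedding (where $\mathcal P(Y_M\cap[a]_\equiv)$ carries the sub-Vietoris topology) such that for any $\eta,\eta'\in 2^{\mathbf N}$: (1) $\phi(\eta)$ is a nonempty closed $G_\delta$; (2) if $\eta\mathrel{\mathbf E_0}\eta'$, then there exists $\gamma\in\Gamma$ fixing $M$ setwise such that $\gamma\cdot\phi(\eta)=\phi(\eta')$ (so in particular the saturations $[\phi(\eta)]_{E^M}$ and $[\phi(\eta')]_{E^M}$ are equal); (3) if $\eta\ne\eta'$, then $\phi(\eta)$ and $\phi(\eta')$ are disjoint; (4) if $\eta,\eta'$ are not $\mathbf E_0$-related, then $(\phi(\eta)\times\phi(\eta'))\cap E^M=\emptyset$.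
   Context: Conventions: $T$ is a complete theory with infinite models (possibly multi-sorted, language of arbitrary cardinality), and $\mathfrak C$ is a monster model: $\kappa$-saturated and strongly $\kappa$-homogeneous for a sufficiently large cardinal $\kappa$. ''Small'' and ''bounded'' mean of cardinality $<\kappa$. Parameter sets are small subsets of $\mathfrak C$; models are elementary substructures of $\mathfrak C$; tuples have small length; sets such as $X$ are subsets of products of sorts of $\mathfrak C$. ''Type-definable'', ''invariant'' mean without parameters unless stated otherwise. A set is $\lambda$-supported if it is a subset of a $\lambda$-fold product of sorts. An equivalence relation is bounded if it has a bounded number of classes. $\equiv$ is the relation of having the same complete type over $\emptyset$, and $[a]_\equiv$ is the set of realisations of $\mathrm{tp}(a/\emptyset)$. For an $A$-invariant set $Z$ put $Z_A=\{\mathrm{tp}(a/A): a\in Z\}\subseteq S(A)$; $Y_M\cap[a]_\equiv$ means the set of types over $M$ of elements of $Y\cap[a]_\equiv$. An invariant set is $F_\sigma$ if the corresponding subset of $S(\emptyset)$ is $F_\sigma$ (an equivalence relation on $X$ is regarded as a subset of $X^2$). A set is pseudo-closed if it is type-definable with parameters from some small set. $Y\subseteq X$ is $E$-saturated if it contains every $E$-class it intersects. For a small model $M$, $E^M$ is the equivalence relation on $S_X(M)=X_M$ given by $p\mathrel{E^M}q$ iff there are $a\models p$, $b\models q$ with $a\mathrel{E}b$ (equivalently, for all such $a,b$); $[F]_{E^M}$ denotes the $E^M$-saturation of $F$. Normal form: a disjunction $\bigvee_{n\in\mathbf N}\Phi_n(x,y)$ of partial types (over $\emptyset$) on $X$,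 with $\Phi_0(x,y)=((x=y)\wedge x\in X)$ and $\Phi_n\vdash\Phi_{n+1}$, is a normal form for $E$ if for all $a,b\in X$: $a\mathrel{E}b$ iff some $\Phi_n(a,b)$ holds, and $d(a,b)=\min\{n:\ \models\Phi_n(a,b)\}$ (with $\min\emptyset=\infty$) is a metric on $X$ with values in $\mathbf N\cup\{\infty\}$. The diameter of a nonempty set with respect to the normal form is the supremum of $d$-distances between its points. Orbital: an invariant equivalence relation is orbital, witnessed by $\Gamma\le\mathrm{Aut}(\mathfrak C)$, if $\Gamma$ preserves each of its classes setwise and acts transitively on each class. $E$ is orbital on types if $a\mathrel{E}b$ implies $a\equiv b$ and the restriction of $E$ to any complete $\emptyset$-type in $X$ is orbital. Sub-Vietoris topology on $\mathcal P(Z)$ (for a topological space $Z$): the topology generated by the subbasis of open sets $\{A\subseteq Z: A\cap K=\emptyset\}$ for $K\subseteq Z$ closed. $\mathbf E_0$ is the relation of eventual equality on $2^{\mathbf N}$.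
   Formalization: The model M is shown to have size at most |T|+λ, and exactly |T|+λ when some sort of the monster model is infinite; if all sorts are finite, the only model is the monster itself, which can be smaller than |T|+λ. *)

(* Defs.v *)
From HB Require Import structures.
From mathcomp Require Import all_boot all_order all_algebra.
From mathcomp Require Import all_classical all_reals all_analysis.
From mathcomp Require Import borel_hierarchy.
Set Implicit Arguments.
Unset Strict Implicit.
Unset Printing Implicit Defensive.

Import Order.TTheory GRing.Theory Num.Theory.
Local Open Scope classical_set_scope.
Local Open Scope card_scope.

Definition card_lt T U (A : set T) (B : set U) : bool :=
  (A #<= B) && ~~ (B #<= A).

Record language := Language {
  Sort : Type;
  FunSym : Type;
  farity : FunSym -> nat;
  fdom : forall f : FunSym, 'I_(farity f) -> Sort;
  fcod : FunSym -> Sort;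
  RelSym : Type;
  rarity : RelSym -> nat;
  rdom : forall r : RelSym, 'I_(rarity r) -> Sort
}.
Arguments fdom {l} f i.
Arguments rdom {l} r i.

(* A context is a family [V : Sort L -> Type]: [V t] is the type of the
   variables of sort [t], which may be infinite. *)
Inductive ext (L : language) (V : Sort L -> Type) (s : Sort L) :
  Sort L -> Type :=
| Old t : V t -> ext V s t
| New : ext V s s.
Arguments Old {L V s t}.
Arguments New {L V s}.

Inductive term (L : language) (V : Sort L -> Type) : Sort L -> Type :=
| Var t : V t -> term V t
| App (f : FunSym L) : (forall i, term V (fdom f i)) -> term V (fcod f).
Arguments Var {L V t}.
Arguments App {L V}.

Inductive formula (L : language) (V : Sort L -> Type) : Type :=
| Equal t : term V t -> term V t -> formula V
| Atomic (r : RelSym L) : (forall i, term V (rdom r i)) -> formula V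
| Bot : formula V
| Imp : formula V -> formula V -> formula V
| All s : formula (ext V s) -> formula V.
Arguments Equal {L V t}.
Arguments Atomic {L V}.
Arguments Bot {L V}.
Arguments Imp {L V}.
Arguments All {L V}.

Definition Not L (V : Sort L -> Type) (phi : formula V) : formula V :=
  Imp phi Bot.

Definition sentence (L : language) : Type := formula (fun _ : Sort L => void).

Definition ext_map L (V W : Sort L -> Type) (f : forall t, V t -> W t)
    (s t : Sort L) (x : ext V s t) : ext W s t :=
  match x with Old _ y => Old (f _ y) | New => New end.

Fixpoint trename L (V W : Sort L -> Type) (f : forall t, V t -> W t)
    (t : Sort L) (u : term V t) : term W t :=
  match u with
  | Var _ x => Var (f _ x)
  | App g a => App g (fun i => trename f (a i))
  end.

Fixpoint rename L (V W : Sort L -> Type) (f : forall t, V t -> W t)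
    (phi : formula V) : formula W :=
  match phi with
  | Equal _ u v => Equal (trename f u) (trename f v)
  | Atomic r a => Atomic r (fun i => trename f (a i))
  | Bot => Bot
  | Imp p q => Imp (rename f p) (rename f q)
  | All s p => All s (rename (ext_map f (s := s)) p)
  end.

Record structure (L : language) := Structure {
  carrier :> Sort L -> Type;
  carrier_inh : forall s, inhabited (carrier s);
  fint : forall f : FunSym L, (forall i, carrier (fdom f i)) -> carrier (fcod f);
  rint : forall r : RelSym L, (forall i, carrier (rdom r i)) -> Prop
}.
Arguments fint {L} C f : rename.
Arguments rint {L} C r : rename.

Definition ext_val L (C : Sort L -> Type) (V : Sort L -> Type)
    (v : forall t, V t -> C t) (s : Sort L) (c : C s) (t : Sort L)
    (x : ext V s t) : C t :=
  match x in ext _ _ t' return C t' with Old _ y => v _ y | New => c end.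

Fixpoint teval L (C : structure L) (V : Sort L -> Type)
    (v : forall t, V t -> C t) (t : Sort L) (u : term V t) : C t :=
  match u in term _ t' return C t' with
  | Var _ x => v _ x
  | App f a => fint C f (fun i => teval v (a i))
  end.

Fixpoint sat L (C : structure L) (V : Sort L -> Type)
    (v : forall t, V t -> C t) (phi : formula V) : Prop :=
  match phi with
  | Equal _ u w => teval v u = teval v w
  | Atomic r a => rint C r (fun i => teval v (a i))
  | Bot => False
  | Imp p q => sat v p -> sat v q
  | All s p => forall c : C s, sat (ext_val v c) p
  end.

Definition holds L (C : structure L) (phi : sentence L) : Prop :=
  sat (C := C) (fun t (x : void) => match x with end) phi.

Definition models L (C : structure L) (T : set (sentence L)) : Prop :=
  forall phi, T phi -> holds C phi.

Definition entails L (T : set (sentence L)) (phi : sentence L) : Prop :=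
  forall C : structure L, models C T -> holds C phi.

Definition complete_theory L (T : set (sentence L)) : Prop :=
  (exists C : structure L, models C T) /\
  (forall phi, entails T phi \/ entails T (Not phi)).

Definition subfam L (C : structure L) : Type := forall t : Sort L, set (C t).

Definition elements L (C : structure L) (A : subfam C) : set {t : Sort L & C t} :=
  [set x | A (projT1 x) (projT2 x)].

Definition emptyp L (C : structure L) : subfam C := fun t => set0.

Definition has_infinite_models L (T : set (sentence L)) : Prop :=
  exists2 C : structure L, models C T & infinite_set [set: {t : Sort L & C t}].

Record substructure L (C : structure L) := Substructure {
  sub_set :> forall t : Sort L, set (C t);
  sub_inh : forall t, @sub_set t !=set0;
  sub_fint : forall (f : FunSym L) (a : forall i, C (fdom f i)),
    (forall i, sub_set (a i)) -> sub_set (fint C f a)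
}.

Lemma induced_inh L (C : structure L) (M : substructure C) (t : Sort L) :
  inhabited (M t).
Proof. by case: (sub_inh M t) => x Mx; exists; exists x; exact: mem_set. Qed.

Definition induced_str L (C : structure L) (M : substructure C) : structure L :=
  @Structure L (fun t => set_type (M t)) (induced_inh M)
    (fun f a => SigSub (mem_set (sub_fint (fun i => set_valP (a i)))))
    (fun r a => rint C r (fun i => val (a i))).

Definition elementary L (C : structure L) (M : substructure C) : Prop :=
  forall (V : Sort L -> Type) (v : forall t, V t -> M t) (phi : formula V),
    sat (C := induced_str M) v phi <-> sat (C := C) (fun t x => val (v t x)) phi.

Record autom L (C : structure L) := Aut {
  aut_fun :> forall t, C t -> C t;
  aut_inv : forall t, C t -> C t;
  aut_funK : forall t, cancel (@aut_fun t) (@aut_inv t);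
  aut_invK : forall t, cancel (@aut_inv t) (@aut_fun t);
  aut_fint : forall f a, aut_fun (fint C f a) = fint C f (fun i => aut_fun (a i));
  aut_rint : forall r a, rint C r (fun i => aut_fun (a i)) <-> rint C r a
}.

Definition aut_one L (C : structure L) : autom C.
Proof. by exists (fun t x => x) (fun t x => x). Defined.

Definition aut_comp L (C : structure L) (g h : autom C) : autom C.
Proof.
exists (fun t x => g t (h t x)) (fun t x => aut_inv h (aut_inv g x)).
- by move=> t x; rewrite !aut_funK.
- by move=> t x; rewrite !aut_invK.
- by move=> f a; rewrite !aut_fint.
- by move=> r a; rewrite (aut_rint g (fun i => h _ (a i))) aut_rint.
Defined.

Definition aut_inverse L (C : structure L) (g : autom C) : autom C.
Proof.
exists (aut_inv g) (aut_fun g); [exact: aut_invK | exact: aut_funK | |].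
- move=> f a; apply: (can_inj (@aut_funK _ _ g _)).
  rewrite aut_invK aut_fint; congr fint.
  by apply: functional_extensionality_dep => i; rewrite aut_invK.
- move=> r a; rewrite -(aut_rint g); have -> // :
    (fun i => g (rdom r i) (aut_inv g (a i))) = a.
  by apply: functional_extensionality_dep => i; rewrite aut_invK.
Defined.

Definition subgroup L (C : structure L) (G : set (autom C)) : Prop :=
  [/\ G (aut_one C), forall g h, G g -> G h -> G (aut_comp g h)
    & forall g, G g -> G (aut_inverse g)].

Definition fixes_setwise L (C : structure L) (g : autom C) (A : subfam C) : Prop :=
  forall t, g t @` A t = A t.

Definition stuple L (C : structure L) (I : Type) (s : I -> Sort L) : Type :=
  forall i : I, C (s i).

Definition aut_tuple L (C : structure L) (I : Type) (s : I -> Sort L)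
    (g : autom C) (x : stuple C s) : stuple C s := fun i => g _ (x i).

Definition sort_cat L (I J : Type) (s : I -> Sort L) (s' : J -> Sort L)
    (k : I + J) : Sort L :=
  match k with inl i => s i | inr j => s' j end.

Definition tuple_cat L (C : structure L) (I J : Type) (s : I -> Sort L)
    (s' : J -> Sort L) (x : stuple C s) (y : stuple C s') :
    stuple C (sort_cat s s') :=
  fun k => match k return C (sort_cat s s' k) with inl i => x i | inr j => y j end.

(* A formula with parameters from [A] treats the elements of [A] as further
   free variables, interpreted by themselves. *)
Inductive pvar L (C : structure L) (I : Type) (s : I -> Sort L) (A : subfam C) :
  Sort L -> Type :=
| TupVar (i : I) : pvar s A (s i)
| Par (t : Sort L) : A t -> pvar s A t.
Arguments TupVar {L C I s A}.
Arguments Par {L C I s A t}.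

Definition pformula L (C : structure L) (I : Type) (s : I -> Sort L)
    (A : subfam C) : Type := formula (pvar s A).

Definition ptval L (C : structure L) (I : Type) (s : I -> Sort L) (A : subfam C)
    (x : stuple C s) (t : Sort L) (w : pvar s A t) : C t :=
  match w in pvar _ _ t' return C t' with TupVar i => x i | Par _ a => val a end.

Definition realises L (C : structure L) (I : Type) (s : I -> Sort L)
    (A : subfam C) (x : stuple C s) (p : set (pformula s A)) : Prop :=
  forall phi, p phi -> sat (ptval x) phi.

Definition type_definable L (C : structure L) (I : Type) (s : I -> Sort L)
    (A : subfam C) (Z : set (stuple C s)) : Prop :=
  exists p : set (pformula s A), Z = [set x | realises x p].

(* The elements of [ctype s A] are the complete types over [A], in the variables
   given by [s], of the theory of [C] with the elements of [A] named. *)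
Definition complete_type L (C : structure L) (I : Type) (s : I -> Sort L)
    (A : subfam C) (p : set (pformula s A)) : Prop :=
  (forall q, finite_set q -> q `<=` p -> exists x : stuple C s, realises x q) /\
  (forall phi, p phi \/ p (Not phi)).

Record ctype L (C : structure L) (I : Type) (s : I -> Sort L) (A : subfam C) :=
  CType {
    ctype_set : set (pformula s A);
    ctypeP : complete_type ctype_set
  }.

Lemma ctype_inj L (C : structure L) (I : Type) (s : I -> Sort L) (A : subfam C)
  (p q : ctype s A) : ctype_set p = ctype_set q -> p = q.
Proof.
case: p q => p Hp [q Hq] /= e; subst q; congr CType; exact: Prop_irrelevance.
Qed.

Section CTypeTopology.
Variables (L : language) (C : structure L) (I : Type) (s : I -> Sort L).
Variable A : subfam C.

HB.instance Definition _ := gen_eqMixin (ctype s A).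
HB.instance Definition _ := gen_choiceMixin (ctype s A).
HB.instance Definition _ := isSubBaseTopological.Build (ctype s A)
  (range (fun phi : pformula s A => [set p : ctype s A | ctype_set p phi])) id.

End CTypeTopology.

Lemma tp_complete L (C : structure L) (I : Type) (s : I -> Sort L)
  (A : subfam C) (x : stuple C s) :
  complete_type [set phi : pformula s A | sat (ptval x) phi].
Proof.
split=> [q _ qp|phi]; first by exists x.
by have [h|h] := pselect (sat (ptval x) phi); [left|right].
Qed.

Definition tp L (C : structure L) (I : Type) (s : I -> Sort L) (A : subfam C)
    (x : stuple C s) : ctype s A := CType (tp_complete A x).

Definition tp_class L (C : structure L) (I : Type) (s : I -> Sort L)
    (a : stuple C s) : set (stuple C s) :=
  [set b | tp (@emptyp L C) b = tp (@emptyp L C) a].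

Lemma teval_rename L (C : structure L) (V W : Sort L -> Type)
  (f : forall t, V t -> W t) (w : forall t, W t -> C t) t (u : term V t) :
  teval w (trename f u) = teval (fun t x => w t (f t x)) u.
Proof.
elim: u => //= g a IH; congr fint.
by apply: functional_extensionality_dep => i; exact: IH.
Qed.

Lemma sat_rename L (C : structure L) (V : Sort L -> Type) (phi : formula V) :
  forall (W : Sort L -> Type) (f : forall t, V t -> W t)
    (w : forall t, W t -> C t),
  sat w (rename f phi) <-> sat (fun t x => w t (f t x)) phi.
Proof.
elim: phi => {V} [V t u v|V r a|V|V p IHp q IHq|V s p IHp] W f w /=.
- by rewrite !teval_rename.
- have -> // : (fun i => teval w (trename f (a i))) =
               (fun i => teval (fun t x => w t (f t x)) (a i)).
  by apply: functional_extensionality_dep => i; rewrite teval_rename.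
- by [].
- by rewrite IHp IHq.
- have E c : (fun t (x : ext V s t) => ext_val w c (ext_map f x)) =
             ext_val (fun t x => w t (f t x)) c.
    apply: functional_extensionality_dep => t.
    by apply: functional_extensionality_dep => -[].
  by split=> h c; [rewrite -E; apply/IHp|apply/IHp; rewrite E].
Qed.

Lemma teval_aut L (C : structure L) (g : autom C) (V : Sort L -> Type)
  (v : forall t, V t -> C t) t (u : term V t) :
  teval (fun t x => g t (v t x)) u = g t (teval v u).
Proof.
elim: u => //= h a IH; rewrite aut_fint; congr fint.
by apply: functional_extensionality_dep => i; exact: IH.
Qed.

Lemma sat_aut L (C : structure L) (g : autom C) (V : Sort L -> Type)
  (phi : formula V) :
  forall v : forall t, V t -> C t,
  sat (fun t x => g t (v t x)) phi <-> sat v phi.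
Proof.
elim: phi => {V} [V t u w|V r a|V|V p IHp q IHq|V s p IHp] v /=.
- by rewrite !teval_aut; split=> [/(can_inj (@aut_funK _ _ g _))|->].
- rewrite -(aut_rint g (fun i => teval v (a i))).
  have -> // : (fun i => teval (fun t x => g t (v t x)) (a i)) =
               (fun i => g _ (teval v (a i))).
  by apply: functional_extensionality_dep => i; rewrite teval_aut.
- by [].
- by rewrite IHp IHq.
- have E c : ext_val (fun t x => g t (v t x)) (g s c) =
             (fun t (x : ext V s t) => g t (ext_val v c x)).
    apply: functional_extensionality_dep => t.
    by apply: functional_extensionality_dep => -[].
  split=> h c; first by apply/IHp; rewrite -E.
  by rewrite -(aut_invK g c) E; apply/IHp.
Qed.

Lemma fixes_inv L (C : structure L) (g : autom C) (A : subfam C) :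
  fixes_setwise g A -> forall t x, A t x -> A t (aut_inv g x).
Proof. by move=> gA t x; rewrite -{1}gA => -[y Ay <-]; rewrite aut_funK. Qed.

Definition par_inv L (C : structure L) (I : Type) (s : I -> Sort L)
    (A : subfam C) (g : autom C) (gA : fixes_setwise g A) (t : Sort L)
    (w : pvar s A t) : pvar s A t :=
  match w with
  | TupVar i => TupVar i
  | Par _ a => Par (SigSub (mem_set (fixes_inv gA (set_valP a))))
  end.

Lemma sat_par_inv L (C : structure L) (I : Type) (s : I -> Sort L)
  (A : subfam C) (g : autom C) (gA : fixes_setwise g A) (x : stuple C s)
  (phi : pformula s A) :
  sat (ptval x) (rename (par_inv gA (s := s)) phi) <->
  sat (ptval (aut_tuple g x)) phi.
Proof.
rewrite sat_rename -(sat_aut g).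
have -> // : (fun t (w : pvar s A t) => g t (ptval x (par_inv gA w))) =
             (fun t => ptval (aut_tuple g x) (t := t)).
apply: functional_extensionality_dep => t.
by apply: functional_extensionality_dep => -[] //= {}t a; exact: aut_invK.
Qed.

Lemma act_complete L (C : structure L) (I : Type) (s : I -> Sort L)
  (A : subfam C) (g : autom C) (gA : fixes_setwise g A) (p : ctype s A) :
  complete_type [set phi | ctype_set p (rename (par_inv gA (s := s)) phi)].
Proof.
have [fs cp] := ctypeP p; split=> [q fq qp|phi]; last exact: cp.
have [|r [phi qphi <-]|x xq] := fs (rename (par_inv gA (s := s)) @` q).
- exact: finite_image.
- exact: qp.
- exists (aut_tuple g x) => phi qphi.
  by apply/(sat_par_inv gA); apply: xq; exists phi.
Qed.

(* [phi(x, m)] belongs to [type_act gA p] iff [phi(x, g^-1 m)] belongs to [p]. *)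
Definition type_act L (C : structure L) (I : Type) (s : I -> Sort L)
    (A : subfam C) (g : autom C) (gA : fixes_setwise g A) (p : ctype s A) :
    ctype s A := CType (act_complete gA p).

Lemma act_tp L (C : structure L) (I : Type) (s : I -> Sort L)
  (A : subfam C) (g : autom C) (gA : fixes_setwise g A) (x : stuple C s) :
  type_act gA (tp A x) = tp A (aut_tuple g x).
Proof.
by apply: ctype_inj; apply/seteqP; split=> phi /= /(sat_par_inv gA).
Qed.

(* [K] is a type of cardinality kappa; the cardinal |T| is the number of
   L-sentences. *)
Section Monster.
Variables (L : language) (K : Type).

Definition small (U : Type) (D : set U) : bool := card_lt D [set: K].

Definition saturated (C : structure L) : Prop :=
  forall (A : subfam C) (t : Sort L), small (elements A) ->
  forall p : ctype (fun _ : unit => t) A,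
  exists x : stuple C (fun _ : unit => t), realises x (ctype_set p).

Definition elementary_map (C : structure L) (A : subfam C)
    (f : forall t, A t -> C t) : Prop :=
  forall phi : formula (fun t => set_type (A t)),
    sat (fun t (x : A t) => val x) phi <-> sat f phi.

Definition strongly_homogeneous (C : structure L) : Prop :=
  forall A : subfam C, small (elements A) ->
  forall f : (forall t, A t -> C t), elementary_map f ->
  exists g : autom C, forall t (x : A t), g t (val x) = f t x.

Definition monster_model (T : set (sentence L)) (C : structure L) : Prop :=
  [/\ models C T, small [set: sentence L], saturated C & strongly_homogeneous C].

Definition pseudo_closed (C : structure L) (I : Type) (s : I -> Sort L)
    (Z : set (stuple C s)) : Prop :=
  exists2 A : subfam C, small (elements A) & type_definable A Z.

Definition bounded (U : Type) (X : set U) (E : U -> U -> Prop) : Prop :=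
  small (E @` X).

End Monster.

Definition equivalence_on (U : Type) (X : set U) (E : U -> U -> Prop) : Prop :=
  [/\ forall x y, E x y -> X x /\ X y, forall x, X x -> E x x,
      forall x y, E x y -> E y x & forall x y z, E x y -> E y z -> E x z].

Definition restr (U : Type) (E : U -> U -> Prop) (D : set U) (x y : U) : Prop :=
  [/\ E x y, D x & D y].

Definition rel_saturated (U : Type) (E : U -> U -> Prop) (Y : set U) : Prop :=
  forall x y, Y x -> E x y -> Y y.

Section Relations.
Variables (L : language) (C : structure L) (I : Type) (s : I -> Sort L).
Notation tup := (stuple C s).
Implicit Types (X D : set tup) (E : tup -> tup -> Prop).

Definition invariant_rel E : Prop :=
  forall (g : autom C) x y, E x y -> E (aut_tuple g x) (aut_tuple g y).

Definition Fsigma_rel E : Prop :=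
  invariant_rel E /\
  Fsigma [set p | exists x y, E x y /\ p = tp (@emptyp L C) (tuple_cat x y)].

(* [E] is an equivalence relation on [X]. *)
Definition orbital_by (G : set (autom C)) X E : Prop :=
  [/\ subgroup G,
      forall g x, G g -> X x -> aut_tuple g @` E x = E x
    & forall x y, E x y -> exists2 g, G g & aut_tuple g x = y].

Definition orbital_on_types X E : Prop :=
  (forall x y, E x y -> tp (@emptyp L C) x = tp (@emptyp L C) y) /\
  (forall x, X x ->
     exists G, orbital_by G (tp_class x) (restr E (tp_class x))).

Definition nf_dist (Phi : nat -> set (pformula (sort_cat s s) (@emptyp L C)))
    (x y : tup) : \bar int :=
  match pselect (exists n, `[< realises (tuple_cat x y) (Phi n) >]) with
  | left h => ((ex_minn h)%:Z)%:E
  | right _ => +oo%E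
  end.

Definition metric_on (U : Type) (X : set U) (d : U -> U -> \bar int) : Prop :=
  [/\ forall x y, X x -> X y -> d x y = 0%E <-> x = y,
      forall x y, X x -> X y -> d x y = d y x
    & forall x y z, X x -> X y -> X z -> (d x z <= d x y + d y z)%E].

Definition normal_form X E
    (Phi : nat -> set (pformula (sort_cat s s) (@emptyp L C))) : Prop :=
  [/\ forall n x y, realises (tuple_cat x y) (Phi n) -> X x /\ X y,
      forall x y, realises (tuple_cat x y) (Phi 0%N) <-> x = y /\ X x,
      forall n x y, realises (tuple_cat x y) (Phi n) ->
                    realises (tuple_cat x y) (Phi n.+1),
      forall x y, X x -> X y ->
        E x y <-> exists n, realises (tuple_cat x y) (Phi n)
    & metric_on X (nf_dist Phi)].

Definition diameter (d : tup -> tup -> \bar int) D : \bar int :=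
  supremum -oo%E [set d x y | x in D & y in D].

(* The relation E^M. *)
Definition type_rel (M : subfam C) E (p q : ctype s M) : Prop :=
  exists a b, [/\ realises a (ctype_set p), realises b (ctype_set q) & E a b].

Definition type_saturation (M : subfam C) X E (F : set (ctype s M)) :
    set (ctype s M) :=
  [set q | (tp M @` X) q /\ exists2 p, F p & type_rel E p q].

End Relations.

Definition sub_vietoris (Z : topologicalType) : Type := set Z.

Section SubVietoris.
Variable Z : topologicalType.

HB.instance Definition _ := gen_eqMixin (sub_vietoris Z).
HB.instance Definition _ := gen_choiceMixin (sub_vietoris Z).
HB.instance Definition _ := isSubBaseTopological.Build (sub_vietoris Z)
  (@closed Z) (fun F => [set A : set Z | A `&` F = set0]).

End SubVietoris.

Definition homeo_embedding (S Z : topologicalType) (f : S -> Z) : Prop :=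
  [/\ injective f, continuous f
    & forall U, open U -> exists2 V, open V & f @` U = V `&` range f].

Definition E0 (eta eta' : nat -> bool) : Prop :=
  exists N, forall n, (N <= n)%N -> eta n = eta' n.

(* Main.v *)
Require Import Defs.
From Stdlib Require List.
From HB Require Import structures.
From mathcomp Require Import all_boot all_order all_algebra.
From mathcomp Require Import all_classical all_reals all_analysis.
From mathcomp Require Import borel_hierarchy.
Set Implicit Arguments.
Unset Strict Implicit.
Unset Printing Implicit Defensive.
Local Open Scope classical_set_scope.
Local Open Scope card_scope.

(** Let [D] be the set of points of [Y] with the type of [a], and call points
    [n]-close when their distance is at most [n].  The group [Gam] moves each
    point of [D] within its class and is transitive on each class; since all
    the points of [D] are conjugate, all their classes have infinite diameter.

    The embedding comes from a tree construction.  There are automorphisms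
    [ga n] in [Gam] and definable sets [th n], each containing [th n.+1] and its
    translate by [ga n].  A branch [eta] selects at stage [n] the piece obtained
    from [th n] by the product of those [ga i], [i < n], for which [eta i] holds.
    Pieces decrease along a branch, so by compactness a branch determines a
    nonempty closed set of types, an intersection of countably many clopen sets.
    If two branches agree after stage [N], the quotient of the two products at
    stage [N] carries one set to the other.  If moreover no point of the piece
    of [eta] at stage [n.+1] is [n]-close to a point of that of [eta'] whenever
    [eta n] and [eta' n] differ, then branches that differ are disjoint, and
    branches that differ infinitely often contain no related types, since
    related points are [n]-close for some [n] (lemma [piece_sep]).

    The difficulty is to keep [th n] large enough to continue.  Largeness is
    membership in an ultrafilter [p] on [D] that lies above a maximal
    [Gam]-invariant filter.  As at a point of a minimal flow, each set in [p] is
    syndetic: finitely many members of [Gam] suffice to correct any translate of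
    [p] so that it contains the set again ([generic_ultrafilter]).  As there are
    few classes, the type of [p] over representatives of all classes is realised,
    and so [p] concentrates near some point [b] of [D] ([ultrafilter_near]).
    Now choose [h] in [Gam] moving [b] very far, and correct it by one of the
    finitely many members so that the result [ga] returns to [th n].  It still
    moves [b] far, even after multiplication by the finitely many quotients of
    products met so far, and compactness then gives a neighbourhood of [b], hence
    a set in [p], whose translates are not [n]-close ([construction_step]).

    Only saturation for single elements is given, so compactness for tuples of
    small infinite length is proved first ([tuple_saturation]).  The model is an
    elementary hull of the parameters of the sets [th n], closed under the
    [ga n] and their inverses ([exists_model]).  Both steps use cardinal
    arithmetic, which rests on comparability and on Hessenberg's theorem. *)

(** * Cardinal arithmetic *)

Definition embeds (A B : Type) : Prop := exists f : A -> B, injective f.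

Lemma embeds_refl A : embeds A A.
Proof. by exists id. Qed.

Lemma embeds_trans B A D : embeds A B -> embeds B D -> embeds A D.
Proof. by move=> [f fi] [g gi]; exists (g \o f); exact: inj_comp. Qed.

Lemma card_leE T U (A : set T) (B : set U) :
  (A #<= B) <-> embeds (set_type A) (set_type B).
Proof.
split=> [/card_leP/injfunPex[f _ fi]|[f fi]].
  by exists f => x y; apply: fi; rewrite inE.
by apply/card_leP/injfunPex; exists f => // x y _ _; exact: fi.
Qed.

Lemma embeds_setT T : embeds T (set_type [set: T]) /\ embeds (set_type [set: T]) T.
Proof.
split; last by exists val; exact: val_inj.
by exists (fun x => SigSub (mem_set (I : [set: T] x))) => x y [].
Qed.

Lemma embeds_surj A B (f : A -> option B) :
  (forall b, exists a, f a = Some b) -> embeds B A.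
Proof.
move=> /choice[g gP]; exists g => x y e.
by apply: Some_inj; rewrite -!gP e.
Qed.

(** A maximal partial injection, given by Zorn's lemma, is total on one of the
    two sides. *)
Lemma embeds_total A B : embeds A B \/ embeds B A.
Proof.
pose P (R : set (A * B)) := forall p q, R p -> R q -> p.1 = q.1 <-> p.2 = q.2.
have [F FP Ftot p q [R FR Rp] [S FS Sq]|R [RP Rmax]] := @Zorn_bigcup _ P.
  have [RS|SR] := Ftot _ _ FR FS; first exact: (FP _ FS) (RS _ Rp) Sq.
  exact: (FP _ FR) Rp (SR _ Sq).
have [domR|/existsNP[a aR]] := pselect (forall a, exists b, R (a, b)).
  left; have [f fP] := choice domR; exists f => x y e.
  exact/(RP _ _ (fP x) (fP y)).
have [ranR|/existsNP[b bR]] := pselect (forall b, exists a, R (a, b)).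
  right; have [f fP] := choice ranR; exists f => x y e.
  exact/(RP _ _ (fP x) (fP y)).
exfalso; apply: (Rmax (R `|` [set (a, b)])).
  split; first by left.
  by move=> /(_ (a, b) (or_intror erefl)) Rab; apply: aR; exists b.
move=> [x y] [x' y'] [Rp|[-> ->]] [Rq|[-> ->]] //=; first exact: RP Rp Rq.
- by split=> e; [case: aR; exists y|case: bR; exists x]; rewrite -e.
- by split=> e; [case: aR; exists y'|case: bR; exists x']; rewrite e.
Qed.

Section Hessenberg.
Variable U : Type.
Implicit Type G : set (U * U * U).

Let fld G : set U := [set x | exists z, G (x, x, z)].

(** [G] is the graph of an injection of the square of [fld G] into [fld G]. *)
Let squaring G : Prop :=
  [/\ forall x y z, G (x, y, z) -> [/\ fld G x, fld G y & fld G z],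
      forall x y, fld G x -> fld G y -> exists z, G (x, y, z)
    & forall p q, G p -> G q -> p.1 = q.1 <-> p.2 = q.2].

Let squaring_fun G : squaring G ->
  exists pr : set_type (fld G) * set_type (fld G) -> set_type (fld G),
    injective pr /\ forall x y, G (val x, val y, val (pr (x, y))).
Proof.
move=> [Gfld Gtot Ginj].
have /choice[pr prP] : forall p : set_type (fld G) * set_type (fld G),
    exists z : set_type (fld G), G (val p.1, val p.2, val z).
  move=> [x y]; have [z Gz] := Gtot _ _ (set_valP x) (set_valP y).
  by have [_ _ fz] := Gfld _ _ _ Gz; exists (SigSub (mem_set fz)).
exists pr; split=> [[x y] [x' y'] e|x y]; last exact: prP (x, y).
have /= := Ginj _ _ (prP (x, y)) (prP (x', y')).
by rewrite e => -[_ /(_ erefl)[/val_inj-> /val_inj->]].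
Qed.

Let squaring_max (f : nat -> U) : injective f ->
  exists G, [/\ squaring G, forall n, fld G (f n) &
    forall G', squaring G' -> G `<=` G' -> G' `<=` G].
Proof.
move=> fi; pose G0 : set (U * U * U) :=
  [set (f p.1, f p.2, f (pickle p)) | p in [set: nat * nat]].
have G0fld n : fld G0 (f n) by exists (f (pickle (n, n))), (n, n).
have G0sq : squaring G0.
  split=> [x y z [[m n] _ [<- <- <-]]|x y|p q] //=.
  - move=> [z [[m ?] _ [<- _ _]]] [z' [[n ?] _ [<- _ _]]].
    by exists (f (pickle (m, n))), (m, n).
  - move=> [[m n] _ <-] [[m' n'] _ <-] /=.
    by split=> [[/fi-> /fi->]|/fi/(pcan_inj pickleK)[-> ->]].
pose P G := squaring G /\ (G = set0 \/ G0 `<=` G).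
have [F FP Ftot|G [[Gsq G0G] Gmax]] := @Zorn_bigcup _ P.
  split.
    have fldS G G' : G `<=` G' -> fld G `<=` fld G'.
      by move=> GG x [z Gz]; exists z; exact: GG.
    split.
    - move=> x y z [G FG] Gxyz; have [[Gfld _ _] _] := FP _ FG.
      have [fx fy fz] := Gfld _ _ _ Gxyz.
      by split; apply: (fldS G) => //; exact: bigcup_sup.
    - move=> x y [z [G FG Gx]] [z' [G' FG' Gy]].
      have [H [FH Hx Hy]] : exists H, [/\ F H, fld H x & fld H y].
        have [GG|GG] := Ftot _ _ FG FG'.
          by exists G'; split=> //; [exists z; exact: GG|exists z'].
        by exists G; split=> //; [exists z|exists z'; exact: GG].
      have [[_ Htot _] _] := FP _ FH; have [w Hw] := Htot _ _ Hx Hy.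
      by exists w, H.
    - move=> p q [G FG Gp] [G' FG' Gq].
      have [GG|GG] := Ftot _ _ FG FG'.
        by have [[_ _ Ginj] _] := FP _ FG'; apply: Ginj => //; exact: GG.
      by have [[_ _ Ginj] _] := FP _ FG; apply: Ginj => //; exact: GG.
  have [[G [FG GG0]]|nF] := pselect (exists G, F G /\ G0 `<=` G).
    by right=> p /GG0 Gp; exists G.
  left; apply/seteqP; split=> // p [G FG Gp].
  have [_ [G0E|GG0]] := FP _ FG; first by rewrite G0E in Gp.
  by case: nF; exists G.
have {}G0G : G0 `<=` G.
  case: G0G => // G0E; exfalso; apply: (Gmax G0); last by split=> //; right.
  rewrite G0E; split=> // /(_ (f 0, f 0, f (pickle (0, 0)))%N) /(_ _)[].
  by exists (0, 0)%N.
exists G; split=> // [n|G' G'sq GG'].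
  by have [z /G0G Gz] := G0fld n; exists z.
apply: contrapT => nGG'; apply: (Gmax G'); first by split.
by split=> //; right; exact: subset_trans GG'.
Qed.

(** Hessenberg's theorem.  Take a maximal injection of the square of a subset
    [A] into [A].  If the complement of [A] embeds into [A] then so does [U],
    by two copies of [A] inside its square.  Otherwise the complement contains
    a copy [B] of [A], and the three products that make up the rest of the
    square of the union of [A] and [B] fit into [B], against maximality. *)
Lemma embeds_square : embeds nat U -> embeds (U * U) U.
Proof.
move=> [f fi]; have [G [Gsq Gf Gmax]] := squaring_max fi.
have [pr [pri prP]] := squaring_fun Gsq.
pose A := set_type (fld G); have [a ai] : exists a : nat -> A, injective a.
  by exists (fun n => SigSub (mem_set (Gf n))) => m n [/fi].
have [[i ii]|[j ji]] := embeds_total A (set_type (~` fld G)); last first.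
  pose c x : A := if pselect (fld G x) is left h
    then pr (SigSub (mem_set h), a 0%N)
    else if pselect ((~` fld G) x) is left h then pr (j (SigSub (mem_set h)), a 1%N)
    else a 0%N.
  have ci : injective c.
    move=> x y; rewrite /c.
    case: (pselect (fld G x)) => [fx|nx]; case: (pselect (fld G y)) => [fy|ny].
    - by move=> /pri[].
    - by case: pselect => [hy|/(_ ny)//] /pri[_ /ai].
    - by case: pselect => [hx|/(_ nx)//] /pri[_ /ai].
    - case: pselect => [hx|/(_ nx)//]; case: pselect => [hy|/(_ ny)//].
      by move=> /pri e; have /ji [] := congr1 fst e.
  exists (fun p => val (pr (c p.1, c p.2))) => -[x y] [x' y'].
  by move=> /val_inj/pri[/ci-> /ci->].
pose c (p : bool * A) : U := if p.1 then val (i p.2) else val p.2.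
have iA x (y : A) : val (i x) = val y -> False.
  have : ~ fld G (val (i x)) := set_valP (i x).
  by move=> nix e; case: nix; rewrite e; exact: set_valP.
have ci : injective c.
  move=> [[] x] [[] y]; rewrite /c /=.
  - by move=> /val_inj/ii->.
  - by move=> /iA.
  - by move=> /esym/iA.
  - by move=> /val_inj->.
(* [c] enumerates [A] (tag [false]) and its copy [B] (tag [true]).  The last
   argument of [pr] keeps apart the images of the three products that involve
   [B]. *)
pose e (p q : bool * A) : bool * A :=
  if p.1 || q.1 then (true, pr (pr (p.2, q.2), a (p.1 + q.1.*2)%N))
  else (false, pr (p.2, q.2)).
have ei p q p' q' : e p q = e p' q' -> p = p' /\ q = q'.
  case: p q p' q' => [[] x] [[] y] [[] x'] [[] y'] //=;
    rewrite /e /=; try by move=> [/pri[/pri[-> ->]]].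
  - by move=> [/pri[_ /ai]].
  - by move=> [/pri[_ /ai]].
  - by move=> [/pri[_ /ai]].
  - by move=> [/pri[_ /ai]].
  - by move=> [/pri[_ /ai]].
  - by move=> [/pri[_ /ai]].
  - by move=> [/pri[-> ->]].
pose G' : set (U * U * U) :=
  [set r | exists p q, r = (c p, c q, c (e p q))].
have G'fld p : fld G' (c p) by exists (c (e p p)), p, p.
exfalso; have := set_valP (i (a 0%N)); apply.
have G'c : G' (val (i (a 0%N)), val (i (a 0%N)),
               c (e (true, a 0%N) (true, a 0%N))).
  by exists (true, a 0%N), (true, a 0%N).
exists (c (e (true, a 0%N) (true, a 0%N))); apply: Gmax G'c.
  split.
  - by move=> x y z [p [q [-> -> ->]]].
  - move=> x y [_ [p [_ [-> _ _]]]] [_ [q [_ [-> _ _]]]].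
    by exists (c (e p q)), p, q.
  - move=> _ _ [p [q ->]] [p' [q' ->]] /=.
    by split=> [[/ci-> /ci->]|/ci/ei[-> ->]].
move=> [[x y] z] Gxyz; have [Gfld _ Ginj] := Gsq.
have [fx fy fz] := Gfld _ _ _ Gxyz.
exists (false, SigSub (mem_set fx)), (false, SigSub (mem_set fy)).
congr (_, _, _); rewrite /c /e /=.
exact/(Ginj _ _ Gxyz (prP (SigSub (mem_set fx)) (SigSub (mem_set fy)))).
Qed.

End Hessenberg.

Lemma embeds_sum U A B : embeds nat U -> embeds A U -> embeds B U ->
  embeds (A + B) U.
Proof.
move=> Ui [f fi] [g gi]; have [h hi] := Ui.
apply: embeds_trans (embeds_square Ui).
exists (fun s => match s with inl x => (h 0%N, f x) | inr y => (h 1%N, g y) end).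
by move=> [x|x] [y|y] [] //; [move=> /fi->|move=> /hi|move=> /hi|move=> /gi->].
Qed.

Lemma embeds_prod U A B : embeds nat U -> embeds A U -> embeds B U ->
  embeds (A * B) U.
Proof.
move=> Ui [f fi] [g gi]; apply: embeds_trans (embeds_square Ui).
by exists (fun p => (f p.1, g p.2)) => -[x y] [x' y'] [/fi-> /gi->].
Qed.

Lemma embeds_seq U : embeds nat U -> embeds (seq U) U.
Proof.
move=> Ui; have [|h hi] := embeds_sum Ui (B := U * U) _ (embeds_square Ui) (A := unit).
  by have [h _] := Ui; exists (fun=> h 0%N) => -[] [].
pose enc := fix enc (l : seq U) : U :=
  if l is x :: l' then h (inr (x, enc l')) else h (inl tt).
exists enc; elim=> [|x l IH] [|y l'] //= /hi // [-> /IH->] //.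
Qed.

Section Small.
Variable K : Type.

Definition below (A : Type) : Prop := embeds A K /\ ~ embeds K A.

Lemma smallE U (D : set U) : small K D <-> below (set_type D).
Proof.
have [KT TK] := embeds_setT K; rewrite /small /card_lt; split.
  move=> /andP[/card_leE DK /negP/card_leE KD]; split.
    exact: embeds_trans DK TK.
  by move=> KD'; apply: KD; exact: embeds_trans TK KD'.
move=> [DK KD]; apply/andP; split.
  by apply/card_leE; exact: embeds_trans DK KT.
by apply/negP => /card_leE /(embeds_trans KT).
Qed.

Lemma below_embeds A B : embeds A B -> below B -> below A.
Proof.
move=> AB [BK KB]; split; first exact: embeds_trans AB BK.
by move=> KA; apply: KB; exact: embeds_trans KA AB.
Qed.

Lemma smallTE U : small K [set: U] <-> below U.
Proof.
have [UT TU] := embeds_setT U; rewrite smallE.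
by split; exact: below_embeds.
Qed.

Lemma below_prod A B : embeds nat K -> below A -> below B -> below (A * B).
Proof.
move=> Ki sA sB.
wlog AB : A B sA sB / embeds A B.
  move=> H; have [|BA] := embeds_total A B; first exact: H.
  apply: below_embeds (H B A sB sA BA).
  by exists (fun p => (p.2, p.1)) => -[x y] [x' y'] [-> ->].
have [Bi|nB] := pselect (embeds nat B).
  by apply: below_embeds sB; apply: embeds_prod => //; exact: embeds_refl.
have finT (V : Type) : ~ embeds nat V -> finite_set [set: V].
  move=> nV; apply/finite_setPn => /card_leE nV'; apply: nV.
  apply: embeds_trans (embeds_trans nV' (embeds_setT V).2).
  exact: (embeds_setT nat).1.
have nA : ~ embeds nat A by move=> nA; exact: nB (embeds_trans nA AB).
have nP : ~ embeds nat (A * B).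
  move=> nP; have := finite_setX (finT _ nA) (finT _ nB).
  rewrite setXTT => /finite_setPn; apply.
  apply/card_leE; apply: embeds_trans (embeds_setT nat).2 _.
  exact: embeds_trans nP (embeds_setT _).1.
split; last by move=> KP; apply: nP; exact: embeds_trans Ki KP.
have [//|KP] := embeds_total (A * B) K.
by case: nP; exact: embeds_trans Ki KP.
Qed.

Lemma below_sum A B : embeds nat K -> below A -> below B -> below (A + B).
Proof.
move=> Ki sA sB; have sb : below bool.
  have nb : ~ embeds nat bool.
    move=> [f fi].
    have := @fintype.leq_card _ _ (f \o @nat_of_ord 3) (inj_comp fi (@ord_inj 3)).
    by rewrite card_ord card_bool.
  have [bK|Kb] := embeds_total bool K; last by case: nb; exact: embeds_trans Kb.
  by split=> // Kb; apply: nb; exact: embeds_trans Kb.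
have [AB|BA] := embeds_total A B.
  have [f fi] := AB; apply: below_embeds (below_prod Ki sb sB).
  exists (fun s => match s with inl x => (true, f x) | inr y => (false, y) end).
  by move=> [x|x] [y|y] // []; [move=> /fi->|move=>->].
have [f fi] := BA; apply: below_embeds (below_prod Ki sb sA).
exists (fun s => match s with inl x => (true, x) | inr y => (false, f y) end).
by move=> [x|x] [y|y] // []; [move=>->|move=> /fi->].
Qed.

End Small.

(** * Finite support of formulas and definable sets *)

Local Notation tagged_list V := (seq {t & V t}).

Lemma In_flatten_map (T : Type) (J : finType) (F : J -> seq T) i x :
  List.In x (F i) -> List.In x (flatten [seq F j | j <- enum J]).
Proof.
move=> Fix; have: i \in enum J by rewrite mem_enum.
elim: (enum J) => //= j r IH; rewrite inE => /orP[/eqP <-|/IH h].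
  by apply/List.in_or_app; left.
by apply/List.in_or_app; right.
Qed.

Lemma In_pmap (T U : Type) (f : T -> option U) (l : seq T) x y :
  List.In x l -> f x = Some y -> List.In y (pmap f l).
Proof.
elim: l => //= z l IH [->|xl] fx; first by rewrite fx; left.
by case: (f z) => [w|] /=; [right|]; exact: IH.
Qed.

Lemma dep_choice (J : Type) (P : J -> Type) (Q : forall j, P j -> Prop) :
  (forall j, exists y, Q j y) -> exists f : (forall j, P j), forall j, Q j (f j).
Proof. by move=> h; exists (fun j => sval (cid (h j))) => j; case: cid. Qed.

Section Support.
Variable L : language.
Implicit Types V W : Sort L -> Type.

Definition covers V W (f : forall t, W t -> V t) (l : tagged_list V) : Prop :=
  forall t (x : V t), List.In (existT V t x) l -> exists y, f t y = x.

Definition supports V (l : tagged_list V) (phi : formula V) : Prop :=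
  forall W (f : forall t, W t -> V t), covers f l -> exists psi, rename f psi = phi.

Lemma term_supported V t (u : term V t) : exists l : tagged_list V,
  forall W (f : forall t, W t -> V t), covers f l -> exists w, trename f w = u.
Proof.
elim: u => {t} [t x|g a IH].
  exists [:: existT V t x] => W f fl.
  by have [|y <-] := fl t x; [left|exists (Var y)].
have [l lP] := choice IH.
exists (flatten [seq l i | i <- enum 'I_(farity g)]) => W f fl.
have /dep_choice[w wP] : forall i, exists w, trename f w = a i.
  by move=> i; apply: lP => t x h; apply: fl; exact: In_flatten_map h.
exists (App g w) => /=; congr App.
by apply: functional_extensionality_dep => i; exact: wP.
Qed.

Definition old_var V (s : Sort L) (x : {t & ext V s t}) : option {t & V t} :=
  match projT2 x with Old t y => Some (existT V t y) | New => None end.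

(** Only finitely many variables occur in a formula.  Stated through renamings,
    this single fact yields the changes of parameters, the locality of
    satisfaction and the translation into sentences that are needed below,
    without any substitution under binders. *)
Lemma formula_supported V (phi : formula V) : exists l, supports l phi.
Proof.
elim: phi => {V} [V t u w|V r a|V|V p [lp IHp] q [lq IHq]|V s p [l IH]].
- have [lu uP] := term_supported u; have [lw wP] := term_supported w.
  exists (lu ++ lw) => W f fl.
  have [|u' <-] := uP W f.
    by move=> ? ? h; apply: fl; apply/List.in_or_app; left.
  have [|w' <-] := wP W f.
    by move=> ? ? h; apply: fl; apply/List.in_or_app; right.
  by exists (Equal u' w').
- have [l lP] := choice (fun i => term_supported (a i)).
  exists (flatten [seq l i | i <- enum 'I_(rarity r)]) => W f fl.
  have /dep_choice[w wP] : forall i, exists w, trename f w = a i.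
    by move=> i; apply: lP => t x h; apply: fl; exact: In_flatten_map h.
  exists (Atomic r w) => /=; congr Atomic.
  by apply: functional_extensionality_dep => i; exact: wP.
- by exists [::] => W f _; exists Bot.
- exists (lp ++ lq) => W f fl.
  have [|p' <-] := IHp W f.
    by move=> ? ? h; apply: fl; apply/List.in_or_app; left.
  have [|q' <-] := IHq W f.
    by move=> ? ? h; apply: fl; apply/List.in_or_app; right.
  by exists (Imp p' q').
- exists (pmap (@old_var V s) l) => W f fl.
  have [|p' <-] := IH _ (ext_map f (s := s)); last by exists (All s p').
  move=> t [t' x|] h; last by exists New.
  have [|y <-] := fl t' x; last by exists (Old y).
  exact: In_pmap h _.
Qed.

Variable C : structure L.

Lemma sat_eq V (v w : forall t, V t -> C t) (phi : formula V) :
  (forall t x, v t x = w t x) -> sat v phi <-> sat w phi.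
Proof.
move=> e; have -> // : v = w.
apply: functional_extensionality_dep => t.
by apply: functional_extensionality_dep => x.
Qed.

Lemma supports_sat V (l : tagged_list V) (phi : formula V)
    (v w : forall t, V t -> C t) :
  supports l phi -> (forall t x, List.In (existT V t x) l -> v t x = w t x) ->
  sat v phi <-> sat w phi.
Proof.
move=> lphi e.
have [|psi <-] := lphi (fun t => {x | List.In (existT V t x) l}) (fun t => sval).
  by move=> t x h; exists (exist _ x h).
by rewrite !sat_rename; apply: sat_eq => t [x h] /=; exact: e.
Qed.

Definition And V (p q : formula V) : formula V := Not (Imp p (Not q)).
Definition Ex V s (p : formula (ext V s)) : formula V := Not (All s (Not p)).

Lemma sat_And V (v : forall t, V t -> C t) p q :
  sat v (And p q) <-> sat v p /\ sat v q.
Proof.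
split=> [h|[hp hq] h]; last exact: h hp hq.
by split; apply: contrapT => n; apply: h.
Qed.

Lemma sat_Ex V (v : forall t, V t -> C t) s (p : formula (ext V s)) :
  sat v (Ex p) <-> exists c, sat (ext_val v c) p.
Proof.
split=> [h|[c hc] h]; last exact: h hc.
by apply: contrapT => n; apply: h => c hc; apply: n; exists c.
Qed.

Section Definable.
Variables (I : Type) (s : I -> Sort L).
Notation tup := (stuple C s).
Implicit Types (A B : subfam C) (Z : set tup).

Definition definable A Z : Prop :=
  exists phi : pformula s A, Z = [set x | sat (ptval x) phi].

Definition subparam A B : Prop := forall t, A t `<=` B t.

Definition allparam : subfam C := fun t => setT.

Lemma definableI A Z Z' : definable A Z -> definable A Z' -> definable A (Z `&` Z').
Proof.
move=> [p ->] [q ->]; exists (And p q).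
by apply/seteqP; split=> x; [exact: iffRL (sat_And _ _ _)|exact: iffLR (sat_And _ _ _)].
Qed.

Lemma definableC A Z : definable A Z -> definable A (~` Z).
Proof. by move=> [p ->]; exists (Not p). Qed.

Lemma definableT A : definable A setT.
Proof. by exists (Not Bot); apply/seteqP; split=> // x _ /=. Qed.

Definition par_incl A B (AB : subparam A B) t (w : pvar s A t) : pvar s B t :=
  match w with
  | TupVar i => TupVar i
  | Par t a => Par (SigSub (mem_set (AB t _ (set_valP a))))
  end.

Lemma ptval_incl A B (AB : subparam A B) (x : tup) t (w : pvar s A t) :
  ptval x (par_incl AB w) = ptval x w.
Proof. by case: w. Qed.

Lemma definableS A B Z : subparam A B -> definable A Z -> definable B Z.
Proof.
move=> AB [p ->]; exists (rename (par_incl AB) p).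
apply/seteqP; split=> x /=; rewrite sat_rename; apply: (iffLR (sat_eq _ _)) => t w;
  by rewrite ptval_incl.
Qed.

Lemma definable_finite_dep A Z : definable A Z ->
  exists l : seq I, forall x y : tup,
    (forall i, List.In i l -> x i = y i) -> Z x -> Z y.
Proof.
move=> [p ->]; have [l lp] := formula_supported p.
pose ix (w : {t & pvar s A t}) : option I :=
  match projT2 w with TupVar i => Some i | Par _ _ => None end.
exists (pmap ix l) => x y xy /=; apply: (iffLR (supports_sat lp _)) => t w wl.
by case: w wl => //= i wl; apply: xy; exact: In_pmap wl _.
Qed.

Lemma definable_finite_param A Z : definable A Z ->
  exists l : tagged_list C, forall B,
    (forall t x, List.In (existT C t x) l -> B t x) -> definable B Z.
Proof.
move=> [p ->]; have [l lp] := formula_supported p.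
pose par (w : {t & pvar s A t}) : option {t & C t} :=
  match projT2 w with TupVar i => None | Par t a => Some (existT C t (val a)) end.
exists (pmap par l) => B lB.
pose W t := {w : pvar s A t | List.In (existT _ t w) l}.
have inB t (a : A t) (h : List.In (existT _ t (Par a)) l) : B t (val a).
  by apply: lB; exact: In_pmap h _.
pose f t (w : W t) : pvar s B t :=
  match w with exist w h =>
    match w in pvar _ _ t return List.In (existT _ t w) l -> pvar s B t with
    | TupVar i => fun=> TupVar i
    | Par t a => fun h => Par (SigSub (mem_set (inB t a h)))
    end h
  end.
have [|q qp] := lp W (fun t => sval); first by move=> t x h; exists (exist _ x h).
exists (rename f q); rewrite -qp; apply/seteqP.
by split=> x /=; rewrite !sat_rename; apply: (iffLR (sat_eq _ _)) => t [[i|t' a] h].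
Qed.

Lemma type_definableE A Z : type_definable A Z <->
  exists F : set (set tup), (forall S, F S -> definable A S) /\
    Z = \bigcap_(S in F) S.
Proof.
split=> [[p ->]|[F [FA ->]]].
  exists [set [set x | sat (ptval x) phi] | phi in p]; split.
    by move=> _ [phi _ <-]; exists phi.
  apply/seteqP; split=> x /= h; first by move=> _ [phi p_phi <-]; exact: h.
  by move=> phi p_phi; apply: (h [set y | sat (ptval y) phi]); exists phi.
exists [set phi | F [set x | sat (ptval x) phi]].
apply/seteqP; split=> x /= h; first by move=> phi /h.
by move=> S FS; have [phi e] := FA _ FS; rewrite e; apply: h; rewrite /= -e.
Qed.

Lemma type_definableS A B Z :
  subparam A B -> type_definable A Z -> type_definable B Z.
Proof.
move=> AB /type_definableE[F [FA ->]]; apply/type_definableE; exists F.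
by split=> // S /FA; exact: definableS.
Qed.

Lemma type_definableI A Z Z' :
  type_definable A Z -> type_definable A Z' -> type_definable A (Z `&` Z').
Proof.
move=> /type_definableE[F [FA ->]] /type_definableE[F' [FA' ->]].
apply/type_definableE; exists (F `|` F').
by split; [move=> S []; [exact: FA|exact: FA']|rewrite bigcap_setU].
Qed.

Lemma definable_aut A B (g : autom C) Z :
  (forall t x, A t x -> B t (aut_inv g x)) ->
  definable A Z -> definable B (aut_tuple g @^-1` Z).
Proof.
move=> AB [p ->].
pose f t (w : pvar s A t) : pvar s B t := match w with
  | TupVar i => TupVar i
  | Par t a => Par (SigSub (mem_set (AB t _ (set_valP a))))
  end.
have e x t (w : pvar s A t) : g t (ptval x (f t w)) = ptval (aut_tuple g x) w.
  by case: w => // t' a; exact: aut_invK.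
have {}e x : sat (ptval x) (rename f p) <-> sat (ptval (aut_tuple g x)) p.
  by rewrite sat_rename -(sat_aut g); apply: sat_eq => t w; exact: e.
by exists (rename f p); apply/seteqP; split=> x /=; rewrite e.
Qed.

End Definable.

Lemma definable_subst (I J : Type) (s : I -> Sort L) (s' : J -> Sort L)
    (A B : subfam C) (h : forall j, pvar s B (s' j)) (Z : set (stuple C s')) :
  subparam A B -> definable A Z ->
  definable B [set x : stuple C s | Z (fun j => ptval x (h j))].
Proof.
move=> AB [p ->].
pose f t (w : pvar s' A t) : pvar s B t := match w with
  | TupVar j => h j
  | Par t a => Par (SigSub (mem_set (AB t _ (set_valP a))))
  end.
by exists (rename f p); apply/seteqP; split=> x /=; rewrite sat_rename;
  apply: (iffLR (sat_eq _ _)) => t [].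
Qed.

End Support.

(** * Saturation for small tuples *)

Lemma finite_list (T : Type) (q : set T) :
  finite_set q -> exists l, forall x, q x <-> List.In x l.
Proof.
elim/Peq: T => T in q *; move=> /finite_seqP[l ->]; exists l => x /=.
elim: l => //= y l IH; rewrite inE; split=> [/orP[/eqP->|/IH]|[->|/IH ->]].
- by left.
- by right.
- by rewrite eqxx.
- by rewrite orbT.
Qed.

Lemma filter_list (T J : Type) (F : set_system T) (l : seq J) (S : J -> set T) :
  Filter F -> (forall j, List.In j l -> F (S j)) ->
  F [set x | forall j, List.In j l -> S j x].
Proof.
move=> FF; elim: l => [|j l IH] FS.
  by apply: filterS filterT => x _ j [].
have Fl := IH (fun i h => FS i (or_intror h)); have Fj := FS j (or_introl erefl).
by apply: filterS (filterI Fj Fl) => x [xj xl] i [<-|/xl].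
Qed.

Lemma ultra_setC (T : Type) (F : set_system T) (S : set T) :
  UltraFilter F -> ~ F S -> F (~` S).
Proof. by move=> FU nFS; case: (in_ultra_setVsetC S FU). Qed.

Lemma filter_consistent (T : Type) (F : set_system T) (S : set T) :
  ProperFilter F -> F S -> ~ F (~` S).
Proof.
move=> FF FS FnS; have [x [Sx nSx]] := filter_ex (filterI FS FnS).
exact: nSx.
Qed.

Section Update.
Variables (I : Type) (P : I -> Type).

Definition upd (f : forall j, P j) (i : I) (a : P i) (j : I) : P j :=
  match pselect (i = j) with left e => eq_rect i P a j e | right _ => f j end.

Lemma upd_same f i a : @upd f i a i = a.
Proof.
rewrite /upd; case: pselect => // e.
by rewrite (Prop_irrelevance e erefl).
Qed.

Lemma upd_diff f i a j : i <> j -> @upd f i a j = f j.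
Proof. by move=> ij; rewrite /upd; case: pselect. Qed.

End Update.

Section SmallSubfamilies.
Variables (L : language) (C : structure L) (K : Type).
Hypothesis Kinf : embeds nat K.

Inductive ran (I : Type) (s : I -> Sort L) (c : stuple C s) :
  forall t, C t -> Prop := Ran (i : I) : ran c (c i).

Lemma small_cover T (J : Type) (D : set T) (f : J -> T) :
  (forall x, D x -> exists j, f j = x) -> below K J -> small K D.
Proof.
move=> Df sJ; apply/smallE; apply: below_embeds sJ.
have [g gP] := choice (fun x : set_type D => Df _ (set_valP x)).
by exists g => x y e; apply: val_inj; rewrite -[LHS]gP -[RHS]gP e.
Qed.

Lemma smallU (A B : subfam C) : small K (elements A) -> small K (elements B) ->
  small K (elements (fun t => A t `|` B t)).
Proof.
move=> /smallE sA /smallE sB.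
pose f (x : set_type (elements A) + set_type (elements B)) :=
  match x with inl x => val x | inr x => val x end.
apply: (small_cover (f := f)); last exact: below_sum.
move=> x [Ax|Bx]; first by exists (inl (SigSub (mem_set (Ax : elements A x)))).
by exists (inr (SigSub (mem_set (Bx : elements B x)))).
Qed.

Lemma small_ran I (s : I -> Sort L) (c : stuple C s) :
  below K I -> small K (elements (ran c)).
Proof.
apply: (small_cover (f := fun i => existT C (s i) (c i))) => -[t x].
by rewrite /elements /= => -[i]; exists i.
Qed.

Hypothesis satC : saturated K C.

Section OneStep.
Variables (I : Type) (s : I -> Sort L) (B : subfam C).
Hypotheses (sI : below K I) (sB : small K (elements B)).
Variables (F : set_system (stuple C s)).
Hypothesis FU : UltraFilter F.
Notation tup := (stuple C s).

Let depends (J : set I) (S : set tup) : Prop :=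
  forall x y : tup, (forall j, J j -> x j = y j) -> S x -> S y.

Let partial (J : set I) (c : tup) : Prop :=
  forall S, definable B S -> F S -> depends J S -> S c.

(** The values of a partial realisation [c] can be renamed back into variables
    and parameters; [F] then transports to a complete 1-type over [B] and the
    values of [c], and a realisation of that type extends [c] by one
    coordinate. *)
Let partial_extend J c i : partial J c -> (forall j, ~ J j -> B (c j)) ->
  ~ J i -> exists a, partial (i |` J) (upd c (i := i) a).
Proof.
move=> Jc cB nJi; pose A' : subfam C := fun t => @B t `|` @ran _ _ c t.
have sA' : small K (elements A') by apply: smallU => //; exact: small_ran.
have rhoE t (a : A' t) : exists w : pvar s B t, [/\ ptval c w = val a,
      forall x y : tup, (forall j, J j -> x j = y j) -> ptval x w = ptval y w
    & B (val a) -> forall x : tup, ptval x w = val a].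
  have [Ba|nBa] := pselect (B (val a)).
    by exists (Par (SigSub (mem_set Ba))).
  have [//|ra] := set_valP a; move: (val a) nBa ra => x nBx rx.
  case: rx nBx => j nBj; exists (TupVar j).
  have Jj : J j by apply: contrapT => nJj; exact/nBj/cB.
  by split=> // y z; exact.
pose rho t (a : A' t) := sval (cid (rhoE t a)).
have rhoP t (a : A' t) : [/\ ptval c (rho t a) = val a,
      forall x y : tup, (forall j, J j -> x j = y j) ->
        ptval x (rho t a) = ptval y (rho t a)
    & B (val a) -> forall x : tup, ptval x (rho t a) = val a].
  exact: svalP (cid (rhoE t a)).
pose tau t (w : pvar (fun _ : unit => s i) A' t) : pvar s B t :=
  match w with TupVar _ => TupVar i | Par t a => rho t a end.
pose p : set (pformula (fun _ : unit => s i) A') :=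
  [set phi | F [set x | sat (ptval x) (rename tau phi)]].
pose tau1 t (w : pvar (fun _ : unit => s i) A' t) : ext (pvar s B) (s i) t :=
  match w with TupVar _ => New | Par t a => Old (rho t a) end.
have psat phi : p phi -> exists a : C (s i), sat (ptval (fun _ : unit => a)) phi.
  move=> Fphi.
  have e x a : sat (ext_val (ptval x) a) (rename tau1 phi) <->
      sat (fun t w => match w in pvar _ _ t' return C t' with
        TupVar _ => a | Par t a => ptval x (rho t a) end) phi.
    by rewrite sat_rename; apply: sat_eq => t [].
  have /sat_Ex[a /e ha] : sat (ptval c) (Ex (rename tau1 phi)).
    apply: (Jc [set x | sat (ptval x) (Ex (rename tau1 phi))]).
    - by exists (Ex (rename tau1 phi)).
    - apply: filterS Fphi => x /= h; apply/sat_Ex; exists (x i); apply/e.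
      by move: h; rewrite sat_rename; apply: (iffLR (sat_eq _ _)) => t [].
    - move=> x y xy /sat_Ex[a /e h]; apply/sat_Ex; exists a; apply/e.
      apply: (iffLR (sat_eq _ _)) h => t [//|t' a'].
      by have [_ e' _] := rhoP _ a'; exact: e'.
  exists a; apply: (iffLR (sat_eq _ _)) ha => t [//|t' a'].
  by have [e' _ _] := rhoP _ a'; exact: e'.
have pc : complete_type p.
  split=> [q fq qp|phi]; last first.
    have [h|h] := pselect (p phi); [by left|right].
    exact: ultra_setC h.
  have [l lq] := finite_list fq.
  have [psi ppsi psil] : exists2 psi, p psi & forall y : stuple C _,
      sat (ptval y) psi -> forall phi, List.In phi l -> sat (ptval y) phi.
    have {lq qp} : forall phi, List.In phi l -> p phi by move=> phi /lq/qp.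
    elim: l => [|phi l IH] lp.
      by exists (Not Bot) => //; apply: filterS filterT => x _ /=.
    have [psi ppsi psil] := IH (fun i h => lp i (or_intror h)).
    exists (And phi psi).
      apply: filterS (filterI (lp phi (or_introl erefl)) ppsi) => x h.
      exact: (iffRL (sat_And _ (rename tau phi) (rename tau psi))) h.
    by move=> y /sat_And[hphi hpsi] chi [<-|] //; exact: psil.
  have [a ha] := psat _ ppsi; exists (fun _ => a) => phi /lq; exact: psil.
have [y yp] := satC sA' (CType pc).
exists (y tt) => S [phi ->] FS dep.
pose P j := pvar (fun _ : unit => s i) A' (s j).
pose cpar j : P j := Par (SigSub (mem_set (or_intror (Ran c j) : A' _ (c j)))).
pose sigma0 : forall j, P j := upd cpar (i := i) (TupVar tt).
pose sigma t (w : pvar s B t) : pvar (fun _ : unit => s i) A' t :=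
  match w with
  | TupVar j => sigma0 j
  | Par t b => Par (SigSub (mem_set (or_introl (set_valP b) : A' _ (val b))))
  end.
have ysigma t (w : pvar s B t) : ptval y (sigma t w) = ptval (upd c (y tt)) w.
  case: w => //= j; have [<-|ij] := pselect (i = j).
    by rewrite /sigma0 !upd_same.
  by rewrite /sigma0 !upd_diff.
suff : p (rename sigma phi).
  move=> /yp; rewrite /= sat_rename; exact: (iffLR (sat_eq _ ysigma)).
have [l lP] := definable_finite_dep (ex_intro _ phi erefl :
  definable B [set x : tup | sat (ptval x) phi]).
(* Two coordinates of [c] may have the same value and be renamed to the same
   variable; this is correct up to a set in [F]. *)
have FE : F [set x : tup | forall j, List.In j l ->
    J j -> x j = ptval x (tau _ (cpar j))].
  apply: filter_list => j _ /=.
  have [Jj|nJj] := pselect (J j); last by apply: filterS filterT => x _ /nJj.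
  have [w1 w2 _] := rhoP _ (SigSub (mem_set (or_intror (Ran c j) : A' _ (c j)))).
  pose eqn := Equal (Var (TupVar j)) (Var (tau _ (cpar j))) : pformula s B.
  suff : F [set x : tup | sat (ptval x) eqn] by apply: filterS => x h _.
  apply: contrapT => /ultra_setC nF.
  have := Jc _ (definableC (ex_intro _ eqn erefl)) nF.
  apply=> [x z xz nx e|]; last by rewrite /= w1.
  by apply: nx; rewrite /= (xz _ Jj) (w2 _ _ xz).
apply: filterS (filterI FS FE) => x [Sx Ex] /=; rewrite sat_rename sat_rename.
pose x' : tup := fun j => ptval x (tau _ (sigma0 j)).
suff: sat (ptval x') phi.
  apply: (iffLR (sat_eq _ _)) => t [j|t' b] //=.
  have bA' : A' t' (val b) by left; exact: set_valP.
  have [_ _ w3] := rhoP _ (SigSub (mem_set bA')).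
  have e : SigSub (mem_set bA') = SigSub (mem_set (or_introl (set_valP b) : A' _ (val b))).
    exact: val_inj.
  by rewrite -e w3 //=; exact: set_valP.
have [z [zx zl]] : exists z : tup, (forall j, (i |` J) j -> x j = z j) /\
    (forall j, List.In j l -> z j = x' j).
  exists (fun j => if pselect ((i |` J) j) then x j else x' j).
  split=> j; first by case: pselect.
  move=> jl; case: pselect => // -[/= ->|Jj] /=; first by rewrite /x' /sigma0 upd_same.
  have ij : i <> j by move=> ij; case: nJi; rewrite ij.
  by rewrite Ex // /x' /sigma0 upd_diff.
by apply: (lP z) => //; exact: dep zx Sx.
Qed.



(** The default values [d] fill the coordinates that are not yet realised; as they
    belong to [B], they are harmless as parameters of the 1-type realised next. *)
Lemma realised_with_default (d : tup) : (forall j, B (d j)) ->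
  exists c, forall S, definable B S -> F S -> S c.
Proof.
move=> dB.
pose good (p : set I * tup) : Prop :=
  partial p.1 p.2 /\ forall j, ~ p.1 j -> p.2 j = d j.
pose R (p q : {p | good p}) : bool := `[< (sval p).1 `<=` (sval q).1 /\
  forall j, (sval p).1 j -> (sval p).2 j = (sval q).2 j >].
have good0 : good (set0, d).
  split=> // S _ FS dep; have [x Sx] := filter_ex FS.
  by apply: dep Sx => j [].
have [||A Atot|[[J c] [/= Jc Jd]] cmax] := @ZL_preorder _ (exist good _ good0) R.
- by move=> p; apply/asboolP; split.
- move=> p q r /asboolP[pq1 pq2] /asboolP[qr1 qr2]; apply/asboolP.
  split; first exact: subset_trans qr1.
  by move=> j pj; rewrite pq2 // qr2 //; exact: pq1.
- pose J := \bigcup_(p in A) (sval p).1.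
  have /dep_choice[c cP] : forall j, exists y : C (s j),
      (forall p, A p -> (sval p).1 j -> (sval p).2 j = y) /\ (~ J j -> y = d j).
    move=> j; have [[p Ap pj]|nJj] := pselect (J j); last first.
      by exists (d j); split=> // p Ap pj; case: nJj; exists p.
    exists ((sval p).2 j); split=> [q Aq qj|[]]; last by exists p.
    have [/asboolP[pq1 pq2]|/asboolP[qp1 qp2]] := Atot _ _ Ap Aq.
      by rewrite pq2.
    by rewrite qp2.
  have Jc : partial J c.
    move=> S SB FS dep; have [l lS] := definable_finite_dep SB.
    have [[p [Ap pl]]|nA] : (exists p, A p /\
        forall j, List.In j l -> J j -> (sval p).1 j) \/ (forall p, ~ A p).
      have [[p0 Ap0]|nA] := pselect (exists p, A p); last first.
        by right=> p Ap; apply: nA; exists p.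
      left; elim: l {lS} => [|j l [p [Ap pl]]]; first by exists p0; split=> // j [].
      have [[q Aq qj]|nJj] := pselect (J j); last first.
        by exists p; split=> // k [<- /nJj|] //; exact: pl.
      have [/asboolP[pq _]|/asboolP[qp _]] := Atot _ _ Ap Aq.
        by exists q; split=> // k [<-|kl] // Jk; apply: pq; exact: pl.
      by exists p; split=> // k [<- _|kl Jk]; [exact: qp|exact: pl].
    - have [pc _] := svalP p.
      (* [S] depends on [J] and also on the finite list [l], hence on the part
         of [l] inside [J], which a single member of the chain covers. *)
      have depp : depends (sval p).1 S.
        move=> x y xy Sx; pose z : tup := fun j => if pselect (J j) then x j else y j.
        apply: (lS z) => [j jl|].
          by rewrite /z; case: pselect => //= Jj; apply: xy; exact: pl.
        by apply: dep Sx => j Jj; rewrite /z; case: pselect.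
      by apply: depp (pc S SB FS depp) => j pj; have [h _] := cP j; exact: h.
    - have [x Sx] := filter_ex FS.
      by apply: dep Sx => j [p /nA].
  have cg : good (J, c) by split=> // j nJj; have [_ h] := cP j; exact: h.
  exists (exist good _ cg) => p Ap; apply/asboolP; split=> [j pj|j pj] /=.
    by exists p.
  by have [h _] := cP j; exact: h.
- have JT i : J i.
    apply: contrapT => nJi.
    have [|a Ja] := partial_extend Jc _ nJi.
      by move=> j nJj; rewrite Jd.
    have gJ : good (i |` J, upd c a).
      split=> //= j nj; rewrite upd_diff; last by move=> ij; apply: nj; left.
      by apply: (Jd j) => Jj; apply: nj; right.
    have /asboolP[/= iJ _] : R (exist good _ gJ) (exist good (J, c) (conj Jc Jd)).
      apply: cmax; apply/asboolP; split=> [j Jj|j Jj] /=; first by right.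
      by rewrite upd_diff // => ij; apply: nJi; rewrite ij.
    by apply: nJi; apply: iJ; left.
  exists c => S SB FS; apply: (Jc S SB FS) => x y xy.
  by have -> : x = y by apply: functional_extensionality_dep => j; exact: xy.
Qed.

End OneStep.

(** Compactness for tuples of any small length, from saturation for 1-types: the
    coordinates are realised one at a time, and Zorn's lemma replaces a
    recursion along a well-order of the index set. *)
Theorem tuple_saturation (I : Type) (s : I -> Sort L) (B : subfam C)
    (F : set_system (stuple C s)) :
  below K I -> small K (elements B) -> ProperFilter F ->
  exists x, forall S, definable B S -> F S -> S x.
Proof.
move=> sI sB FF; have [G [GU FG]] := ultraFilterLemma FF.
have [d _] := filter_ex (@filterT _ F _).
pose B' : subfam C := fun t => B t `|` @ran _ _ d t.
have [||c cP] := @realised_with_default _ s B' sI _ G GU d.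
- by apply: smallU => //; exact: small_ran.
- by move=> j; right.
exists c => S SB FS; apply: cP; last exact: FG.
by apply: definableS SB => t x; left.
Qed.

End SmallSubfamilies.

(** * Consequences of saturation and homogeneity *)

Section Monster.
Variables (L : language) (C : structure L) (K : Type).
Hypothesis Kinf : embeds nat K.

Lemma finite_In (T : Type) (l : seq T) : finite_set [set x | List.In x l].
Proof.
elim: l => [|y l IH] /=; first exact: finite_set0.
have -> : [set x | y = x \/ List.In x l] = [set y] `|` [set x | List.In x l].
  by apply/seteqP; split=> x [->|]; [left|right|left|right].
by rewrite finite_setU; split=> //; exact: finite_set1.
Qed.

(** Otherwise all points of the sort could serve as parameters, and the type of a
    new point would be realised. *)
Lemma infinite_sort_large (t : Sort L) :
  saturated K C -> infinite_set [set: C t] -> embeds K (C t).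
Proof.
move=> satC infC; have [CK|//] := embeds_total (C t) K.
apply: contrapT => KC; pose s (_ : unit) := t.
pose B : subfam C := @ran _ C _ (fun _ : C t => t) id.
have sB : small K (elements B) by exact: small_ran.
pose F := filter_from [set: seq (C t)]
  (fun l => [set x : stuple C s | ~ List.In (x tt) l]).
have FF : ProperFilter F.
  apply: filter_from_proper => [|l _].
    apply: filter_from_filter => [|l l' _ _]; first by exists [::].
    exists (l ++ l') => // x nx.
    by split=> h; apply: nx; apply/List.in_or_app; [left|right].
  apply: contrapT => nl; apply: infC.
  apply: sub_finite_set (finite_In l) => x _ /=.
  by apply: contrapT => nx; apply: nl; exists (fun=> x).
have unitK : below K unit.
  split; first by have [h _] := Kinf; exists (fun=> h 0%N) => -[] [].
  move=> Ku; have [h hi] := embeds_trans Kinf Ku.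
  by have := hi 0%N 1%N; case: (h 0%N) (h 1%N) => -[] /(_ erefl).
have [x xP] := tuple_saturation Kinf satC unitK sB FF.
apply: (xP [set y | y tt <> x tt]) => //; last first.
  by exists [:: x tt] => // y ny e; apply: ny; left.
pose par : pvar s B t := Par (SigSub (mem_set (Ran _ (x tt) : B t (x tt)))).
by exists (Not (Equal (Var (TupVar tt)) (Var par))).
Qed.

Lemma tp_empty_sat I (s : I -> Sort L) (a b : stuple C s)
    (phi : pformula s (@emptyp L C)) :
  tp (@emptyp L C) b = tp (@emptyp L C) a -> sat (ptval a) phi <-> sat (ptval b) phi.
Proof.
move=> /(congr1 (fun q => ctype_set q phi)) /= e.
by split=> h; [rewrite e|rewrite -e].
Qed.

(** Strong homogeneity speaks of maps between subsets, not of tuples; a value is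
    renamed to one of the coordinates that take it, and tuples of the same type
    have the same coincidences between coordinates. *)
Lemma tp_homogeneous I (s : I -> Sort L) (a b : stuple C s) :
  strongly_homogeneous K C -> below K I ->
  tp (@emptyp L C) b = tp (@emptyp L C) a -> exists g : autom C, aut_tuple g a = b.
Proof.
move=> homC sI ab; pose A : subfam C := @ran _ C _ _ a.
have rhoE t (x : A t) : exists w : pvar s (@emptyp L C) t, ptval a w = val x.
  move: (val x) (set_valP x) => y ry.
  by case: ry => i; exists (TupVar i).
pose rho t (x : A t) := sval (cid (rhoE t x)).
have rhoP t (x : A t) : ptval a (rho t x) = val x by exact: svalP (cid (rhoE t x)).
have [|g gP] := homC A (small_ran _ sI) (fun t x => ptval b (rho t x)).
  move=> phi; transitivity (sat (ptval a) (rename rho phi)).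
    by rewrite sat_rename; apply: sat_eq => t x; rewrite rhoP.
  by rewrite (tp_empty_sat _ ab) sat_rename.
exists g; apply: functional_extensionality_dep => i.
pose x : A (s i) := SigSub (mem_set (Ran a i)).
rewrite /aut_tuple (gP _ x) -[RHS]/(ptval b (TupVar i : pvar s (@emptyp L C) _)).
have [e _] := tp_empty_sat (Equal (Var (rho _ x)) (Var (TupVar i))) ab.
by apply: e; rewrite /= rhoP.
Qed.

End Monster.

(** * Generic ultrafilters *)

(** An ultrafilter above a maximal [G]-invariant filter.  If no finite union of
    translates of [S] is large for the filter, the complements of the translates
    of [S] can be added to it; so each [S] in the ultrafilter is syndetic: every
    member of [G], corrected by one of finitely many others, returns to [S].
    This is the combinatorial form of a point of a minimal flow. *)
Lemma generic_ultrafilter (T : Type) (G : set (T -> T)) (D : set T) :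
  G id -> (forall g h, G g -> G h -> G (g \o h)) -> D !=set0 ->
  (forall g x, G g -> D x -> D (g x)) ->
  exists p : set_system T, [/\ UltraFilter p, p D &
    forall S, p S -> exists l : seq (T -> T), (forall g, List.In g l -> G g) /\
      forall h, G h -> exists g, List.In g l /\ p [set x | S (g (h x))]].
Proof.
move=> G1 GM [d Dd] GD.
pose good (F : set_system T) : Prop :=
  [/\ ProperFilter F, F D & forall g S, G g -> F S -> F (g @^-1` S)].
pose R (F F' : {F | good F}) : bool := `[< sval F `<=` sval F' >].
have good0 : good (globally D).
  split=> //; first by apply: globally_properfilter; exact: Dd.
  by move=> g S Gg DS x Dx; apply: DS; exact: GD.
have [||A Atot|[F [FF FD FG]] Fmax] := @ZL_preorder _ (exist good _ good0) R.
- by move=> F; apply/asboolP.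
- by move=> ? ? ? /asboolP h /asboolP h'; apply/asboolP; exact: subset_trans h'.
- have [[F0 AF0]|nA] := pselect (exists F, A F); last first.
    by exists (exist good _ good0) => F AF; case: nA; exists F.
  have gA : good (\bigcup_(F in A) sval F).
    split.
    - apply: Build_ProperFilter_ex.
        by move=> S [F AF FS]; have [FF _ _] := svalP F; exact: filter_ex FS.
      split.
      + by exists F0 => //; have [FF _ _] := svalP F0; exact: filterT.
      + move=> S S' [F AF FS] [F' AF' FS'].
        have [/asboolP h|/asboolP h] := Atot _ _ AF AF'.
          by exists F' => //; have [FF _ _] := svalP F'; apply: filterI => //; exact: h.
        by exists F => //; have [FF _ _] := svalP F; apply: filterI => //; exact: h.
      + move=> S S' SS [F AF FS]; exists F => //; have [FF _ _] := svalP F.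
        exact: filterS FS.
    - by exists F0 => //; have [] := svalP F0.
    - move=> g S Gg [F AF FS]; exists F => //; have [_ _ FG] := svalP F.
      exact: FG.
  by exists (exist good _ gA) => F AF; apply/asboolP => S FS; exists F.
- have [p [pU Fp]] := ultraFilterLemma FF.
  exists p; split=> //; first exact: Fp.
  move=> S pS; apply: contrapT => nS.
  pose F' : set_system T := [set Q | exists P l, [/\ F P,
    forall g, List.In g l -> G g &
    forall x, P x -> (forall g, List.In g l -> ~ S (g x)) -> Q x]].
  have gF' : good F'.
    split.
    - apply: Build_ProperFilter_ex.
        move=> Q [P [l [FP lG PQ]]]; apply: contrapT => nQ.
        apply: nS; exists l; split=> // h Gh.
        have ph : p (h @^-1` P) by apply: Fp; exact: (FG h P Gh FP).
        apply: contrapT => nl.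
        have pl : p [set x | forall g, List.In g l -> ~ S (g (h x))].
          apply: filter_list => g gl; apply: ultra_setC => pg.
          by apply: nl; exists g.
        have [x [Px xl]] := filter_ex (filterI ph pl).
        by apply: nQ; exists (h x); exact: PQ.
      split.
      + by exists setT, [::]; split=> //; exact: filterT.
      + move=> Q Q' [P [l [FP lG PQ]]] [P' [l' [FP' lG' PQ']]].
        exists (P `&` P'), (l ++ l'); split; first exact: filterI.
          by move=> g gll; case: (List.in_app_or _ _ _ gll) => [/lG|/lG'].
        move=> x [Px P'x] xl; split.
          by apply: PQ => // g gl; apply: xl; apply/List.in_or_app; left.
        by apply: PQ' => // g gl; apply: xl; apply/List.in_or_app; right.
      + move=> Q Q' QQ [P [l [FP lG PQ]]]; exists P, l; split=> // x Px xl.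
        by apply: QQ; exact: PQ.
    - by exists D, [::]; split.
    - move=> h Q Gh [P [l [FP lG PQ]]].
      exists (h @^-1` P), [seq g \o h | g <- l]; split; first exact: (FG h P Gh FP).
        move=> g gl; have [g' [<- /lG Gg']] := iffLR (List.in_map_iff _ _ _) gl.
        exact: GM.
      move=> x Px xl; apply: PQ => // g gl; apply: (xl (g \o h)).
      exact: List.in_map gl.
  have /asboolP/= F'F : R (exist good _ gF') (exist good F (And3 FF FD FG)).
    by apply: Fmax; apply/asboolP => P FP /=; exists P, [::]; split.
  apply: (filter_consistent _ pS); apply: Fp; apply: F'F.
  exists setT, [:: id]; split=> [|g [<-|]|x _ xl] //; first exact: filterT.
  by apply: (xl id); left.
Qed.

(** * The distance of a normal form *)

Section NormalForm.
Variables (L : language) (C : structure L) (I : Type) (s : I -> Sort L).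
Notation tup := (stuple C s).
Variables (X : set tup) (E : tup -> tup -> Prop).
Variable Phi : nat -> set (pformula (sort_cat s s) (@emptyp L C)).
Hypotheses (eqE : equivalence_on X E) (nfE : normal_form X E Phi).

(** The distance is used only through the relations saying that it is at most
    [n]. *)
Definition close n (x y : tup) : Prop := realises (tuple_cat x y) (Phi n).

Lemma close_le m n x y : (m <= n)%N -> close m x y -> close n x y.
Proof.
have [_ _ Phi_S _ _] := nfE.
by elim: n => [|n IH]; rewrite leq_eqVlt => /orP[/eqP-> //|] // /IH h /h /Phi_S.
Qed.

Lemma close_dom n x y : close n x y -> X x /\ X y.
Proof. by have [h _ _ _ _] := nfE; exact: h. Qed.

Lemma E_close x y : E x y -> exists n, close n x y.
Proof.
have [_ _ _ h _] := nfE; have [EX _ _ _] := eqE => Exy.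
by have [Xx Xy] := EX _ _ Exy; apply/h.
Qed.

Lemma close_refl x : X x -> close 0 x x.
Proof. by have [_ h _ _ _] := nfE => Xx; apply/h. Qed.

Lemma nf_dist_le n x y : (nf_dist Phi x y <= (n%:Z)%:E)%E <-> close n x y.
Proof.
rewrite /nf_dist; case: pselect => [h|nh]; last first.
  by split=> // xy; case: nh; exists n; apply/asboolP.
case: ex_minnP => m /asboolP xym min_m; rewrite lee_fin lez_nat.
split=> [mn|xyn]; first exact: close_le xym.
by apply: min_m; exact/asboolP.
Qed.

Lemma close_sym n x y : close n x y -> close n y x.
Proof.
move=> xy; have [Xx Xy] := close_dom xy; have [_ _ _ _ [_ dC _]] := nfE.
by apply/nf_dist_le; rewrite dC //; exact/nf_dist_le.
Qed.

Lemma close_trans y m n x z :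
  close m x y -> close n y z -> close (m + n) x z.
Proof.
move=> xy yz; have [Xx Xy] := close_dom xy; have [_ Xz] := close_dom yz.
have [_ _ _ _ [_ _ dT]] := nfE; apply/nf_dist_le.
apply: Order.POrderTheory.le_trans (dT x y z Xx Xy Xz) _; rewrite PoszD EFinD.
by apply: leeD; exact/nf_dist_le.
Qed.

(** In the extended integers the supremum is [+oo] only for sets without a finite
    upper bound; for the empty set it is [-oo]. *)
Lemma infinite_diameter a n : diameter (nf_dist Phi) (E a) = +oo%E ->
  exists x y, [/\ E a x, E a y & ~ close n x y].
Proof.
rewrite /diameter /supremum; case: eqP => // _; case: xgetP => // z _ [_ lub] zoo; rewrite {}zoo in lub.
apply: contrapT => nxy; suff /lub : ubound [set nf_dist Phi x y | x in E a & y in E a] (n%:Z)%:E.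
  by rewrite leye_eq.
move=> _ [x Ex [y Ey <-]]; apply/nf_dist_le.
by apply: contrapT => nw; apply: nxy; exists x, y.
Qed.

Lemma sat_aut_tuple J (s' : J -> Sort L) (g : autom C) (x : stuple C s')
    (phi : pformula s' (@emptyp L C)) :
  sat (ptval (aut_tuple g x)) phi <-> sat (ptval x) phi.
Proof.
apply: iff_trans (sat_aut g phi (ptval x)); apply: sat_eq => t [//|t' b].
by case: (set_valP b).
Qed.

Lemma tuple_cat_aut (g : autom C) (x y : tup) :
  tuple_cat (aut_tuple g x) (aut_tuple g y) = aut_tuple g (tuple_cat x y).
Proof. by apply: functional_extensionality_dep => -[]. Qed.

Lemma close_aut (g : autom C) n x y :
  close n (aut_tuple g x) (aut_tuple g y) <-> close n x y.
Proof.
by split=> h phi /h; rewrite tuple_cat_aut sat_aut_tuple.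
Qed.

Lemma aut_tupleK (g : autom C) (x : tup) : aut_tuple (aut_inverse g) (aut_tuple g x) = x.
Proof. by apply: functional_extensionality_dep => i; exact: aut_funK. Qed.

Lemma aut_tupleVK (g : autom C) (x : tup) : aut_tuple g (aut_tuple (aut_inverse g) x) = x.
Proof. by apply: functional_extensionality_dep => i; exact: aut_invK. Qed.

(** For [l] ranging over the finite lists of formulas of [Phi m], these sets
    generate the filter of definable neighbourhoods of the closed ball of radius
    [m] around [b]. *)
Definition nbhd (l : seq (pformula (sort_cat s s) (@emptyp L C))) (b x : tup) : Prop :=
  forall phi, List.In phi l -> sat (ptval (tuple_cat x b)) phi.

Lemma nbhd_aut (g : autom C) l b x : nbhd l (aut_tuple g b) (aut_tuple g x) <-> nbhd l b x.
Proof.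
by split=> h phi /h; rewrite tuple_cat_aut sat_aut_tuple.
Qed.

Lemma definable_section (B : subfam C) (b : tup) (Z : set (stuple C (sort_cat s s))) :
  (forall i, B _ (b i)) -> definable (@emptyp L C) Z ->
  definable B [set x : tup | Z (tuple_cat x b)].
Proof.
move=> Bb ZA.
pose h (k : I + I) : pvar s B (sort_cat s s k) :=
  match k return pvar s B (sort_cat s s k) with
  | inl i => TupVar i | inr i => Par (SigSub (mem_set (Bb i))) end.
have -> : [set x : tup | Z (tuple_cat x b)] = [set x | Z (fun k => ptval x (h k))].
  apply/funext => x; congr Z; apply: functional_extensionality_dep => -[] //.
by apply: definable_subst ZA => t x [].
Qed.

Lemma definable_nbhd (B : subfam C) l b :
  (forall i, B _ (b i)) -> definable B (nbhd l b).
Proof.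
move=> Bb; elim: l => [|phi l IH].
  have -> : nbhd [::] b = setT by apply/seteqP; split=> // x _ phi [].
  exact: definableT.
have -> : nbhd (phi :: l) b =
    [set x | sat (ptval (tuple_cat x b)) phi] `&` nbhd l b.
  apply/seteqP; split=> x.
    by move=> h; split=> [|psi pl]; apply: h; [left|right].
  by move=> [h1 h2] psi [<- //|]; exact: h2.
apply: definableI => //.
by apply: (definable_section (Z := [set z | sat (ptval z) phi])) => //; exists phi.
Qed.

End NormalForm.

(** * The inductive step *)

Lemma list_bound (T : Type) (l : seq T) (P : T -> nat -> Prop) :
  (forall x m n, (m <= n)%N -> P x m -> P x n) ->
  (forall x, List.In x l -> exists n, P x n) ->
  exists n, forall x, List.In x l -> P x n.
Proof.
move=> Ple; elim: l => [|y l IH] Pl; first by exists 0%N.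
have [m my] := Pl y (or_introl erefl).
have [n nl] := IH (fun x h => Pl x (or_intror h)).
exists (maxn m n) => x [<-|xl]; first by apply: Ple my; exact: leq_maxl.
by apply: Ple (nl x xl); exact: leq_maxr.
Qed.

Section Step.
Variables (L : language) (C : structure L) (K : Type).
Hypotheses (Kinf : embeds nat K) (satC : saturated K C).
Variables (I : Type) (s : I -> Sort L).
Notation tup := (stuple C s).
Hypothesis IK : below K I.
Variables (X : set tup) (E : tup -> tup -> Prop).
Variable Phi : nat -> set (pformula (sort_cat s s) (@emptyp L C)).
Hypotheses (eqE : equivalence_on X E) (nfE : normal_form X E Phi).
Hypothesis bddE : bounded K X E.
Variables (A : subfam C) (D : set tup) (Gam : set (autom C)).
Hypotheses (sA : small K (elements A)) (D_td : type_definable A D).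
Hypotheses (D_ne : D !=set0) (DX : D `<=` X).
Hypothesis D_E : forall x y, D x -> E x y -> D y.
Hypotheses (GamG : subgroup Gam).
Hypothesis Gam_E : forall g x, Gam g -> D x -> E x (aut_tuple g x).
Hypothesis D_inf : forall x n, D x ->
  exists g, Gam g /\ ~ close Phi n x (aut_tuple g x).
Notation close := (close Phi).

Let D_Gam g x : Gam g -> D x -> D (aut_tuple g x).
Proof. by move=> Gg Dx; exact: (D_E Dx (Gam_E Gg Dx)). Qed.

Section Ultrafilter.
Variable p : set_system tup.
Hypotheses (pU : UltraFilter p) (pD : p D).

(** This is where boundedness is used.  Representatives of all classes form a
    small set of parameters; the type that [p] induces over these is realised
    by a point of [D], which is at finite distance from one of the
    representatives. *)
Lemma ultrafilter_near : exists b m, D b /\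
  forall l, (forall phi, List.In phi l -> Phi m phi) -> p (nbhd l b).
Proof.
have [EX Erefl Esym Etrans] := eqE.
have repE (Q : set_type (E @` X)) : exists x, X x /\ E x = val Q.
  by have [x Xx e] := set_valP Q; exists x.
have [r rP] := choice repE.
pose c (k : set_type (E @` X) * I) : C (s k.2) := r k.1 k.2.
pose B : subfam C := fun t => @A t `|` @ran _ _ _ (fun k => s k.2) c t.
have sB : small K (elements B).
  apply: smallU => //; apply: small_ran => //; apply: below_prod => //.
  exact/smallE.
have [x xP] := tuple_saturation Kinf satC IK sB (@ultra_proper _ _ pU).
have Dx : D x.
  have /type_definableE[F [FA DF]] := D_td.
  rewrite DF => S FS; apply: xP.
    by apply: definableS (FA _ FS) => t y; left.
  by apply: filterS pD; rewrite DF => y; exact.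
have EXx : (E @` X) (E x) by exists x => //; exact: DX.
pose Q : set_type (E @` X) := SigSub (mem_set EXx).
have Exb : E x (r Q).
  by have [Xr e] := rP Q; rewrite -[E x]/(val Q) -e; exact: Erefl.
have [m mx] := E_close eqE nfE Exb.
exists (r Q), m; split=> [|l lm]; first exact: (D_E Dx Exb).
suff h phi : Phi m phi -> p [set y | sat (ptval (tuple_cat y (r Q))) phi].
  by apply: filter_list => phi /lm; exact: h.
move=> mphi; apply: contrapT => /ultra_setC np.
have := xP _ _ np; apply=> //; last exact: mx.
apply/definableC/(definable_section (Z := [set z | sat (ptval z) phi])).
  by move=> i; right; exact: (Ran c (Q, i)).
by exists phi.
Qed.

End Ultrafilter.

(** Otherwise some [x] and [z] would be [m]-close to [b] and [b'] and [n]-close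
    to each other, by compactness. *)
Lemma separation m n b b' : ~ close (m + n + m) b b' ->
  exists l, (forall phi, List.In phi l -> Phi m phi) /\
    forall x z, nbhd l b x -> nbhd l b' z -> ~ close n x z.
Proof.
move=> nbb'; apply: contrapT => nsep.
pose fst_ (y : stuple C (sort_cat s s)) : tup := fun i => y (inl i).
pose snd_ (y : stuple C (sort_cat s s)) : tup := fun i => y (inr i).
have catK y : tuple_cat (fst_ y) (snd_ y) = y.
  by apply: functional_extensionality_dep => -[].
pose F := filter_from [set l | forall phi, List.In phi l -> Phi m phi]
  (fun l => [set y | [/\ nbhd l b (fst_ y), nbhd l b' (snd_ y)
                       & close n (fst_ y) (snd_ y)]]).
have FF : ProperFilter F.
  apply: filter_from_proper => [|l lm].
    apply: filter_from_filter => [|l l' lm lm']; first by exists [::].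
    exists (l ++ l').
      by move=> phi h; case: (List.in_app_or _ _ _ h) => [/lm|/lm'].
    move=> y [y1 y2 y3]; split; split=> // phi h; [apply: y1|apply: y2|apply: y1|apply: y2];
      apply/List.in_or_app; by [left|right].
  apply: contrapT => ne; apply: nsep; exists l; split=> // x z bx bz xz.
  by apply: ne; exists (tuple_cat x z).
pose B : subfam C := fun t => @ran _ _ _ _ b t `|` @ran _ _ _ _ b' t.
have sB : small K (elements B) by apply: smallU => //; exact: small_ran.
have [y yP] := tuple_saturation Kinf satC (below_sum Kinf IK IK) sB FF.
have B0 : subparam (@emptyp L C) B by move=> t x [].
have defF (c : tup) (h : forall i, pvar (sort_cat s s) B (s i))
      (phi : pformula (sort_cat s s) (@emptyp L C)) :
    (forall i, B _ (c i)) ->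
    definable B [set y : stuple C (sort_cat s s) |
      sat (ptval (tuple_cat (fun i => ptval y (h i)) c)) phi].
  move=> Bc; apply: (definable_subst (Z := [set x : tup |
    sat (ptval (tuple_cat x c)) phi]) h (A := B)); first by move=> t x.
  by apply: (definable_section (Z := [set z | sat (ptval z) phi])) => //; exists phi.
have y1 : close m (fst_ y) b.
  move=> phi mphi; apply: (yP [set y | sat (ptval (tuple_cat (fst_ y) b)) phi]).
    apply: (defF b (fun i => TupVar (inl i))) => i; left; exact: Ran.
  exists [:: phi] => [psi [<-|]|z [h _ _]] //; apply: h; by left.
have y2 : close m (snd_ y) b'.
  move=> phi mphi; apply: (yP [set y | sat (ptval (tuple_cat (snd_ y) b')) phi]).
    apply: (defF b' (fun i => TupVar (inr i))) => i; right; exact: Ran.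
  exists [:: phi] => [psi [<-|]|z [_ h _]] //; apply: h; by left.
have y3 : close n (fst_ y) (snd_ y).
  move=> phi nphi; apply: (yP [set y | sat (ptval (tuple_cat (fst_ y) (snd_ y))) phi]).
    apply: (definableS B0); exists phi; apply/funext => z; by rewrite /= catK.
  by exists [::] => // z [_ _ h]; exact: h.
apply: nbb'; apply: (close_trans nfE) y2.
by apply: (close_trans nfE) y3; exact: (close_sym nfE).
Qed.

Lemma ultrafilter_shrink (p : set_system tup) (J : Type) (l : seq J)
    (P : J -> set tup -> Prop) :
  Filter p -> (forall j S S', S' `<=` S -> P j S -> P j S') ->
  (forall j, List.In j l -> exists S, [/\ p S, definable (@allparam L C) S & P j S]) ->
  exists S, [/\ p S, definable (@allparam L C) S & forall j, List.In j l -> P j S].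
Proof.
move=> pF PS; elim: l => [|j l IH] lP.
  by exists setT; split=> //; [exact: filterT|exact: definableT].
have [S [pS dS jS]] := lP j (or_introl erefl).
have [S' [pS' dS' lS']] := IH (fun i h => lP i (or_intror h)).
exists (S `&` S'); split; [exact: filterI|exact: definableI|].
by move=> i [<-|il]; [apply: PS jS|apply: PS (lS' i il)] => x [].
Qed.

(** The ultrafilter is kept throughout the construction.  Syndeticity returns
    some far translate of it to [S]; being near one point [b], it stays far
    from its translates by all the automorphisms of [l]. *)
Lemma construction_step : exists p : set_system tup, [/\ UltraFilter p, p D &
  forall S n (l : seq (autom C)), p S -> definable (@allparam L C) S ->
    (forall k, List.In k l -> Gam k) ->
  exists ga S', [/\ Gam ga, p S', definable (@allparam L C) S' &
    [/\ S' `<=` S, forall x, S' x -> S (aut_tuple ga x) &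
    forall k x y, List.In k l -> S' x -> S' y ->
      ~ close n x (aut_tuple k (aut_tuple ga y))]]].
Proof.
have [G1 GM GV] := GamG.
have [p [pU pD psyn]] : exists p : set_system tup, [/\ UltraFilter p, p D &
    forall S, p S -> exists l : seq (autom C), (forall g, List.In g l -> Gam g) /\
      forall h, Gam h -> exists g, List.In g l /\
        p [set x | S (aut_tuple g (aut_tuple h x))]].
  have [|||p [pU pD psyn]] := @generic_ultrafilter tup
      [set aut_tuple g | g in Gam] D _ _ D_ne.
  - by exists (aut_one C).
  - move=> _ _ [g Gg <-] [h Gh <-]; exists (aut_comp g h) => //; exact: GM.
  - by move=> _ x [g Gg <-]; exact: D_Gam.
  exists p; split=> // S /psyn[l [lG lP]].
  have [l' [l'G l'l]] : exists l' : seq (autom C), (forall g, List.In g l' -> Gam g) /\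
      forall f, List.In f l -> exists2 g, List.In g l' & aut_tuple g = f.
    elim: l lG {lP} => [|f l IH] lG; first by exists [::].
    have [l' [l'G l'l]] := IH (fun g h => lG g (or_intror h)).
    have [g Gg gf] := lG f (or_introl erefl).
    exists (g :: l'); split=> [h [<-|/l'G]|h [<-|/l'l[k kl' <-]]] //.
      by exists g => //; left.
    by exists k => //; right.
  exists l'; split=> // h Gh.
  have [f [fl pf]] := lP _ (ex_intro2 _ _ h Gh erefl).
  by have [g gl' gf] := l'l f fl; exists g; split=> //; rewrite gf.
exists p; split=> // S n l pS dS lG.
have [b [m [Db pb]]] := ultrafilter_near pU pD.
have [gs [gsG gsP]] := psyn S pS.
(* The correction [g] is chosen only after [h], but among finitely many; so the
   displacement that [h] must exceed can be bounded beforehand. *)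
pose back (g k : autom C) := aut_comp (aut_inverse g) (aut_inverse k).
have backG g k : Gam g -> Gam k -> Gam (back g k).
  by move=> Gg Gk; apply: GM; exact: GV.
have [M MP] : exists M, forall g, List.In g gs -> forall k, List.In k l ->
    close M b (aut_tuple (back g k) b).
  apply: list_bound => [g i j ij h k kl|g ggs].
    by apply: (close_le nfE ij); exact: h.
  apply: list_bound => [k i j ij|k kl]; first exact: (close_le nfE ij).
  apply: (E_close eqE nfE); apply: Gam_E => //.
  by apply: backG; [exact: gsG|exact: lG].
have [h [Gh hb]] := D_inf (M + (m + n + m)) Db.
have [g [ggs pg]] := gsP h Gh; pose ga := aut_comp g h.
have Gga : Gam ga by apply: GM => //; exact: gsG.
have far k : List.In k l ->
    ~ close (m + n + m) b (aut_tuple k (aut_tuple ga b)).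
  move=> kl kb; apply: hb; apply: (close_trans nfE) (MP _ ggs _ kl) _.
  apply/(close_aut _ g)/(close_aut _ k).
  rewrite -[aut_tuple (back g k) b]/(aut_tuple (aut_inverse g)
    (aut_tuple (aut_inverse k) b)).
  by rewrite !aut_tupleVK.
have [] := @ultrafilter_shrink p _ l (fun k Q => forall x y, Q x -> Q y ->
    ~ close n x (aut_tuple k (aut_tuple ga y))) _ _ _.
- by move=> k Q Q' QQ h' x y Q'x Q'y; apply: h'; exact: QQ.
- move=> k kl; have [q [qm qsep]] := separation (far k kl).
  exists (nbhd q b); split; first exact: pb.
    exact: definable_nbhd.
  by move=> x y qx qy; apply: qsep => //; apply/nbhd_aut/nbhd_aut.
move=> Q [pQ dQ Qsep].
exists ga, (S `&` (aut_tuple ga @^-1` S) `&` Q); split=> //.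
- by apply: filterI => //; exact: filterI.
- apply: definableI => //; apply: definableI => //.
  exact: definable_aut dS.
split; [by move=> x [[]]|by move=> x [[]]|].
by move=> k x y kl [_ Qx] [_ Qy]; exact: Qsep.
Qed.

End Step.

(** * Elementary hulls *)

Lemma existT_inj (T : Type) (P : T -> Type) t (x y : P t) :
  existT P t x = existT P t y -> x = y.
Proof.
by move=> e; have := projT2_eq e; rewrite (Prop_irrelevance (projT1_eq e) erefl).
Qed.

Lemma In_rev (T : Type) (l : seq T) x : List.In x (rev l) -> List.In x l.
Proof.
elim: l => //= y l IH; rewrite rev_cons -cats1 => h.
by case: (List.in_app_or _ _ _ h) => [/IH|[->|]] //; [right|left].
Qed.

Section Hull.
Variables (L : language) (C : structure L).
Notation point := {t : Sort L & C t}.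

(** [counterexample v phi m x] holds when [phi] starts with quantifiers over the
    sorts of the points of [m] and one more, and [x] refutes what is left once
    the first ones are instantiated with [m].  Sentences together with finite
    lists of points thus index all Skolem functions, which makes counting
    formulas unnecessary. *)
Fixpoint counterexample V (v : forall t, V t -> C t) (phi : formula V)
    (m : seq point) (x : point) : Prop :=
  match phi with
  | All s p =>
    match m with
    | [::] => exists c : C s, x = existT _ s c /\ ~ sat (ext_val v c) p
    | y :: m' => exists c : C s, y = existT _ s c /\ counterexample (ext_val v c) p m' x
    end
  | _ => False
  end.

Definition void_val (t : Sort L) (x : void) : C t := match x with end.

Fixpoint lctx (m : seq point) : Sort L -> Type :=
  if m is x :: m' then ext (lctx m') (projT1 x) else fun=> void.

Fixpoint lval (m : seq point) : forall t, lctx m t -> C t :=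
  match m return forall t, lctx m t -> C t with
  | [::] => void_val
  | x :: m' => ext_val (lval (m := m')) (projT2 x)
  end.

Fixpoint lclose (m : seq point) : formula (lctx m) -> sentence L :=
  match m return formula (lctx m) -> sentence L with
  | [::] => id
  | x :: m' => fun p => lclose (All (projT1 x) p)
  end.

Lemma lcloseP m (p : formula (lctx m)) m2 x :
  counterexample void_val (lclose p) (rev m ++ m2) x <->
  counterexample (lval (m := m)) p m2 x.
Proof.
elim: m => [//|[s c] m IH] in p m2 *.
rewrite rev_cons cat_rcons /= IH /=; split=> [[c' [e]]|h]; last by exists c.
by rewrite (existT_inj e).
Qed.

Lemma counterexample_rename V W (f : forall t, W t -> V t) (v : forall t, V t -> C t)
    (w : forall t, W t -> C t) (q : formula W) x :
  (forall t y, w t y = v t (f t y)) ->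
  counterexample w q [::] x <-> counterexample v (rename f q) [::] x.
Proof.
move=> e; case: q => //= s p.
suff h c : sat (ext_val w c) p <-> sat (ext_val v c) (rename (ext_map f (s := s)) p).
  by split=> -[c [-> /h nc]]; exists c.
by rewrite sat_rename; apply: sat_eq => t [].
Qed.

Section Closed.
Variable M : subfam C.
Hypothesis M_skolem : forall (phi : sentence L) m,
  (forall x, List.In x m -> M (projT2 x)) ->
  (exists x, counterexample void_val phi m x) ->
  exists x, M (projT2 x) /\ counterexample void_val phi m x.

(** The finitely many variables that occur in [p] are listed and their values
    turned into points; the formula becomes a sentence to which the closure
    hypothesis on [M] applies. *)
Lemma closed_counterexample V (v : forall t, V t -> C t) s (p : formula (ext V s)) :
  (forall t x, M (v t x)) -> (exists c, ~ sat (ext_val v c) p) ->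
  exists c, M c /\ ~ sat (ext_val v c) p.
Proof.
move=> Mv [c nc]; have [l lP] := formula_supported (All s p).
have [m [f [Mm fl fv]]] : exists m, exists f : forall t, lctx m t -> V t,
    [/\ forall x, List.In x m -> M (projT2 x), covers f l
      & forall t y, lval y = v t (f t y)].
  elim: l {lP} => [|[t x] l [m [f [Mm fl fv]]]].
    exists [::], (fun t (y : void) => match y with end).
    by split=> [x []|t x []|t []].
  exists (existT _ t (v t x) :: m).
  exists (fun t' (y : ext (lctx m) t t') =>
    match y in ext _ _ t' return V t' with Old _ z => f _ z | New => x end).
  split.
  - by move=> y [<-|/Mm] //=.
  - move=> t' y [e|/fl[z <-]]; last by exists (Old z).
    have te : t = t' := projT1_eq e.
    by case: t' / te in y e *; exists New; rewrite (existT_inj e).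
  - by move=> t' [t1 y|] /=.
have [q qp] := lP _ f fl.
have cq x : counterexample void_val (lclose q) (rev m) x <->
    exists c' : C s, x = existT _ s c' /\ ~ sat (ext_val v c') p.
  rewrite -[rev m]cats0; apply: iff_trans (lcloseP _ _ _) _.
  by apply: iff_trans (counterexample_rename _ _ fv) _; rewrite qp.
have [||x [Mx /cq[c' [xc nc']]]] := M_skolem (phi := lclose q) (m := rev m).
- by move=> x xm; apply: Mm; exact: In_rev.
- by exists (existT _ s c); apply/cq; exists c.
by exists c'; split=> //; rewrite xc in Mx.
Qed.

Lemma closed_inh t : @M t !=set0.
Proof.
have [c] := carrier_inh C t.
have [||x [Mx _]] := @closed_counterexample _ (@void_val) t Bot; first by move=> ? [].
  by exists c => /=.
by exists x.
Qed.

Lemma closed_fint (f : FunSym L) (a : forall i, C (fdom f i)) :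
  (forall i, M (a i)) -> M (fint C f a).
Proof.
move=> Ma.
pose V := @pvar L C _ (fdom f) (@emptyp L C).
pose p : formula (ext V (fcod f)) := Not (Equal (Var New)
  (App f (fun i => Var (Old (TupVar i : V (fdom f i)))))).
have [||c [Mc]] := @closed_counterexample V (@ptval _ _ _ _ _ a) _ p.
- by move=> t [i|t' b]; [exact: Ma|case: (set_valP b)].
- by exists (fint C f a) => /=; apply.
by move=> /contrapT /= <-.
Qed.

Definition closed_substructure : substructure C :=
  Substructure closed_inh closed_fint.

(** The Tarski-Vaught test. *)
Lemma closed_elementary : elementary closed_substructure.
Proof.
have tev V (v : forall t, V t -> closed_substructure t) t (u : term V t) :
    val (teval (C := induced_str closed_substructure) v u) =
    teval (C := C) (fun t x => val (v t x)) u.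
  elim: u => //= f a IH; congr fint.
  by apply: functional_extensionality_dep => i; rewrite -IH.
move=> V v phi; elim: phi => {V} [V t u w|V r a|V|V p IHp q IHq|V s p IHp] in v * => /=.
- by rewrite -!tev; split=> [->|/val_inj].
- have -> // : (fun i => val (teval (C := induced_str closed_substructure) v (a i))) =
      (fun i => teval (C := C) (fun t x => val (v t x)) (a i)).
  by apply: functional_extensionality_dep => i; exact: tev.
- by [].
- by rewrite IHp IHq.
- have e (c : closed_substructure s) :
      sat (C := C) (fun t x => val (ext_val v c x)) p <->
      sat (ext_val (fun t x => val (v t x)) (val c)) p.
    by apply: sat_eq => t [].
  split=> h c; last by apply/IHp/e.
  apply: contrapT => nc.
  have [||c' [Mc' nc']] := @closed_counterexample V (fun t x => val (v t x)) s p.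
  + by move=> t x; exact: set_valP.
  + by exists c.
  apply: nc'; have := h (SigSub (mem_set Mc')).
  by move=> /IHp/e.
Qed.

End Closed.

Section Generated.
Variables (U : Type) (base : U -> option point) (g : nat -> autom C).
Hypotheses (Uinf : embeds nat U) (LU : embeds (sentence L) U).

Let skolem (phi : sentence L) (m : seq point) : option point :=
  if pselect (exists x, counterexample void_val phi m x) is left h
  then Some (sval (cid h)) else None.

Let move_point (n : nat) (x : point) : point :=
  existT _ (projT1 x) ((if odd n then aut_inv (g n./2) else g n./2) _ (projT2 x)).

(** The hull is enumerated by finite trees: a leaf names a basic point, and a
    node applies a Skolem function, named by its first child, or one of the
    automorphisms and their inverses, named by its label. *)
Fixpoint tree_point (t : GenTree.tree (U + sentence L)) : option point :=
  match t with
  | GenTree.Leaf (inl u) => base u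
  | GenTree.Leaf (inr _) => None
  | GenTree.Node n ts =>
    match ts with
    | GenTree.Leaf (inr phi) :: ts' => skolem phi (pmap tree_point ts')
    | t' :: _ => omap (move_point n) (tree_point t')
    | [::] => None
    end
  end.

Definition hull : subfam C := fun t x => exists u, tree_point u = Some (existT _ t x).

Lemma hull_base u t x : base u = Some (existT _ t x) -> hull x.
Proof. by exists (GenTree.Leaf (inl u)). Qed.

Lemma hull_move n t (x : C t) : hull x ->
  hull ((if odd n then aut_inv (g n./2) else g n./2) _ x).
Proof.
move=> [u ux]; exists (GenTree.Node n [:: u]).
case: u ux => [[u|phi]|n' ts] //.
  by move=> /= ->.
by move=> h /=; rewrite -/(tree_point (GenTree.Node n' ts)) h.
Qed.

Lemma hull_fixes n : fixes_setwise (g n) hull.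
Proof.
move=> t; apply/seteqP; split=> [_ [x hx <-]|x hx].
  by have := hull_move n.*2 hx; rewrite odd_double doubleK.
exists (aut_inv (g n) x); last exact: aut_invK.
have := hull_move n.*2.+1 hx.
by rewrite /= odd_double /= uphalf_double.
Qed.

Lemma hull_skolem (phi : sentence L) m :
  (forall x, List.In x m -> hull (projT2 x)) ->
  (exists x, counterexample void_val phi m x) ->
  exists x, hull (projT2 x) /\ counterexample void_val phi m x.
Proof.
move=> mh ex; have [ts tsm] : exists ts, pmap tree_point ts = m.
  elim: m mh {ex} => [|[t x] m IH] mh; first by exists [::].
  have [ts tsm] := IH (fun y h => mh y (or_intror h)).
  have [u ux] := mh _ (or_introl erefl).
  by exists (u :: ts) => /=; rewrite ux tsm.
have [x skx cx] : exists2 x, skolem phi m = Some x & counterexample void_val phi m x.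
  rewrite /skolem; case: pselect => // h; exists (sval (cid h)) => //.
  exact: svalP (cid h).
exists x; split=> //; exists (GenTree.Node 0 (GenTree.Leaf (inr phi) :: ts)).
by rewrite /= tsm skx; case: (x).
Qed.

Lemma hull_card : elements hull #<= [set: U].
Proof.
apply/card_leE; apply: embeds_trans (embeds_setT U).1.
apply: (@embeds_trans (GenTree.tree (U + sentence L))).
  pose f u : option (set_type (elements hull)) :=
    if tree_point u is Some x then
      if pselect (elements hull x) is left h then Some (SigSub (mem_set h)) else None
    else None.
  apply: (embeds_surj (f := f)) => -[x xP].
  have hx := set_mem xP; have [u ux] := hx; exists u; rewrite /f ux.
  have -> : existT _ (projT1 x) (projT2 x) = x by case: (x).
  by case: pselect => // h; congr Some; exact: val_inj.
apply: (@embeds_trans (seq (nat + (U + sentence L)))).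
  by exists (@GenTree.encode _); exact: pcan_inj (GenTree.codeK _).
have [f fi] : embeds (nat + (U + sentence L)) U.
  by apply: embeds_sum => //; apply: embeds_sum => //; exact: embeds_refl.
apply: embeds_trans (embeds_seq Uinf); exists (map f); exact: inj_map.
Qed.

Lemma elementary_hull : exists M : substructure C,
  [/\ elementary M, elements M #<= [set: U], forall n, fixes_setwise (g n) M
    & forall u t x, base u = Some (existT _ t x) -> M t x].
Proof.
exists (closed_substructure hull_skolem); split.
- exact: closed_elementary.
- exact: hull_card.
- exact: hull_fixes.
- exact: hull_base.
Qed.

End Generated.
End Hull.

(** * The tree of pieces *)

Lemma decreasing_le (T : Type) (S : nat -> set T) m n :
  (forall n, S n.+1 `<=` S n) -> (m <= n)%N -> S n `<=` S m.
Proof.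
move=> Sdec; elim: n => [|n IH]; rewrite leq_eqVlt => /orP[/eqP->|] //.
by move=> /IH; apply: subset_trans; exact: Sdec.
Qed.

Section Tree.
Variables (L : language) (C : structure L) (I : Type) (s : I -> Sort L).
Notation tup := (stuple C s).

Section Path.
Variable ga : nat -> autom C.

Fixpoint path (eta : nat -> bool) (n : nat) : autom C :=
  if n is m.+1 then
    if eta m then aut_comp (path eta m) (ga m) else path eta m
  else aut_one C.

Lemma path_agree eta eta' n :
  (forall i, (i < n)%N -> eta i = eta' i) -> path eta n = path eta' n.
Proof.
elim: n => //= n IH e; rewrite e // IH // => i ni.
by apply: e; exact: ltnW.
Qed.

(** The factors after stage [N] coincide, so the products differ by the quotient
    of the factors before. *)
Lemma path_tail eta eta' N n (y : tup) :
  (forall i, (N <= i)%N -> eta i = eta' i) -> (N <= n)%N ->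
  aut_tuple (path eta' n) y = aut_tuple (path eta' N)
    (aut_tuple (aut_inverse (path eta N)) (aut_tuple (path eta n) y)).
Proof.
move=> e; elim: n y => [|n IH] y; rewrite leq_eqVlt => /orP[/eqP<-|Nn] //.
- by rewrite aut_tupleK.
- by rewrite aut_tupleK.
- rewrite /= -e //; case: (eta n); last exact: IH.
  exact: (IH (aut_tuple (ga n) y)).
Qed.

Lemma path_group (G : set (autom C)) eta n :
  subgroup G -> (forall n, G (ga n)) -> G (path eta n).
Proof.
by move=> [G1 GM _] Gga; elim: n => //= n IH; case: (eta n) => //; exact: GM.
Qed.

Lemma path_fixes (M : subfam C) eta n :
  (forall n, fixes_setwise (ga n) M) -> fixes_setwise (path eta n) M.
Proof.
move=> gaM; elim: n => /= [|n IH] t; first by rewrite image_id.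
case: (eta n) => //.
by rewrite -[RHS]IH -[in RHS](gaM n t) -image_comp.
Qed.

End Path.

Variables (X : set tup) (E : tup -> tup -> Prop).
Variable Phi : nat -> set (pformula (sort_cat s s) (@emptyp L C)).
Hypotheses (nfE : normal_form X E Phi).
Variables (Gam : set (autom C)) (GamG : subgroup Gam).
Variable p : set_system tup.
Hypothesis pF : Filter p.
Hypothesis step : forall S n (l : seq (autom C)),
  p S -> definable (@allparam L C) S -> (forall k, List.In k l -> Gam k) ->
  exists ga S', [/\ Gam ga, p S', definable (@allparam L C) S' &
    [/\ S' `<=` S, forall x, S' x -> S (aut_tuple ga x) &
    forall k x y, List.In k l -> S' x -> S' y ->
      ~ close Phi n x (aut_tuple k (aut_tuple ga y))]].

(** The state carries, with the current set, a list containing the products of all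
    branches; the step is applied to the quotients of these products. *)
Lemma tree_exists : exists ga th, [/\ forall n, Gam (ga n), forall n, p (th n),
    forall n, definable (@allparam L C) (th n) &
  [/\ forall n, th n.+1 `<=` th n, forall n x, th n.+1 x -> th n (aut_tuple (ga n) x) &
    forall n eta eta' x y, th n.+1 x -> th n.+1 y ->
      ~ close Phi n (aut_tuple (path ga eta n) x)
                    (aut_tuple (path ga eta' n) (aut_tuple (ga n) y))]].
Proof.
have [G1 GM GV] := GamG.
pose good (st : seq (autom C) * set tup) := [/\ forall k, List.In k st.1 -> Gam k,
  p st.2 & definable (@allparam L C) st.2].
have /choice[F FP] : forall q : nat * (seq (autom C) * set tup),
    exists r : autom C * set tup, good q.2 ->
    [/\ Gam r.1, p r.2, definable (@allparam L C) r.2 &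
    [/\ r.2 `<=` q.2.2, forall x, r.2 x -> q.2.2 (aut_tuple r.1 x) &
    forall g h x y, List.In g q.2.1 -> List.In h q.2.1 -> r.2 x -> r.2 y ->
      ~ close Phi q.1 (aut_tuple g x) (aut_tuple h (aut_tuple r.1 y))]].
  move=> [n [l S]]; have [[/= lG pS dS]|ng] := pselect (good (l, S)); last first.
    by exists (aut_one C, setT).
  pose l' := List.flat_map (fun g => [seq aut_comp (aut_inverse g) h | h <- l]) l.
  have [k /List.in_flat_map[g [gl /List.in_map_iff[h [<- hl]]]]|ga [S' [Gga pS' dS' [S'S gaS' sep]]]] :=
    step n (l := l') pS dS.
    by apply: GM; [apply: GV|]; exact: lG.
  exists (ga, S') => _ /=; split=> //; split=> // g h x y gl hl S'x S'y gh.
  apply: (sep (aut_comp (aut_inverse g) h) x y) => //.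
    apply/List.in_flat_map; exists g; split=> //.
    exact: (List.in_map (fun h => aut_comp (aut_inverse g) h)).
  apply/(close_aut _ g); move: gh; congr close.
  by rewrite -[RHS]/(aut_tuple g (aut_tuple (aut_inverse g) _)) aut_tupleVK.
pose st := fix st n : seq (autom C) * set tup := match n with
  | 0 => ([:: aut_one C], setT)
  | m.+1 => let: (l, _) := st m in let: (g, S') := F (m, st m) in
            (l ++ [seq aut_comp h g | h <- l], S')
  end.
pose ga n := (F (n, st n)).1.
have stS n : st n.+1 = ((st n).1 ++ [seq aut_comp h (ga n) | h <- (st n).1],
                        (F (n, st n)).2).
  by rewrite /ga /=; case: (st n) => l Q; case: (F _).
have st_good n : good (st n).
  elim: n => [|n IH].
    split=> [k [<-|]||] //=; [exact: filterT|exact: definableT].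
  rewrite stS; have [Gg pS dS _] := FP (n, st n) IH.
  have [lG _ _] := IH; split=> //= k kl.
  have [/lG //|kl'] := List.in_app_or _ _ _ kl.
  have [h [<- /lG Gh]] := iffLR (List.in_map_iff _ _ _) kl'.
  exact: GM.
have path_st eta n : List.In (path ga eta n) (st n).1.
  elim: n => [|n IH]; first by left.
  rewrite stS /=; apply/List.in_or_app; case: (eta n); last by left.
  right; exact: (List.in_map (fun h => aut_comp h (ga n)) _ _ IH).
have thS n : (st n.+1).2 = (F (n, st n)).2 by rewrite stS.
exists ga, (fun n => (st n).2); split.
- by move=> n; have [] := FP (n, st n) (st_good n).
- by move=> n; have [] := st_good n.
- by move=> n; have [] := st_good n.
have FPn n := FP (n, st n) (st_good n).
split=> n; rewrite thS.
- by have [_ _ _ []] := FPn n.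
- by have [_ _ _ [_ h _]] := FPn n.
- move=> eta eta' x y; have [_ _ _ [_ _ h]] := FPn n.
  by apply: h; exact: path_st.
Qed.

End Tree.

Section Pieces.
Variables (L : language) (C : structure L) (I : Type) (s : I -> Sort L).
Notation tup := (stuple C s).
Variables (X : set tup) (E : tup -> tup -> Prop).
Variable Phi : nat -> set (pformula (sort_cat s s) (@emptyp L C)).
Hypotheses (nfE : normal_form X E Phi).
Variables (ga : nat -> autom C) (th : nat -> set tup).
Hypothesis thS : forall n, th n.+1 `<=` th n.
Hypothesis th_ga : forall n x, th n.+1 x -> th n (aut_tuple (ga n) x).
Hypothesis th_sep : forall n eta eta' x y, th n.+1 x -> th n.+1 y ->
  ~ close Phi n (aut_tuple (path ga eta n) x)
                (aut_tuple (path ga eta' n) (aut_tuple (ga n) y)).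

Definition piece (eta : nat -> bool) (n : nat) : set tup :=
  aut_tuple (aut_inverse (path ga eta n)) @^-1` th n.

Lemma pieceP eta n x :
  piece eta n x <-> exists2 y, th n y & x = aut_tuple (path ga eta n) y.
Proof.
split=> [h|[y thy ->]]; last by rewrite /piece /= aut_tupleK.
by exists (aut_tuple (aut_inverse (path ga eta n)) x) => //; rewrite aut_tupleVK.
Qed.

Lemma piece_dec eta n : piece eta n.+1 `<=` piece eta n.
Proof.
move=> x /pieceP[y thy ->]; apply/pieceP => /=; case: (eta n); last first.
  by exists y => //; exact: thS.
by exists (aut_tuple (ga n) y) => //; exact: th_ga.
Qed.

Lemma piece_agree eta eta' n :
  (forall i, (i < n)%N -> eta i = eta' i) -> piece eta n = piece eta' n.
Proof. by move=> e; rewrite /piece (path_agree ga e). Qed.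

(** One of the two branches takes [ga n] and the other does not; the products
    before stage [n] are among those that the choice of [ga n] took care of. *)
Lemma piece_sep eta eta' n x y : eta n <> eta' n ->
  piece eta n.+1 x -> piece eta' n.+1 y -> ~ close Phi n x y.
Proof.
move=> en /pieceP[x' thx ->] /pieceP[y' thy ->] /=.
case: (eta n) (eta' n) en => -[] // _ h; last exact: (th_sep thx thy) h.
exact: (th_sep thy thx) (close_sym nfE h).
Qed.

Lemma piece_tail eta eta' N x :
  (forall i, (N <= i)%N -> eta i = eta' i) -> (forall n, piece eta n x) ->
  forall n, piece eta' n
    (aut_tuple (aut_comp (path ga eta' N) (aut_inverse (path ga eta N))) x).
Proof.
move=> e xn n.
have h m : (N <= m)%N -> piece eta' m
    (aut_tuple (aut_comp (path ga eta' N) (aut_inverse (path ga eta N))) x).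
  move=> Nm; have /pieceP[y thy xy] := xn m; apply/pieceP; exists y => //.
  by rewrite (path_tail _ _ e Nm) -xy.
have := h _ (leq_maxr n N).
exact: (decreasing_le (S := piece eta') (@piece_dec eta') (leq_maxl n N)).
Qed.

End Pieces.


(** * Topology *)

Lemma subbase_nbhd (I : choiceType) (T : Type) (D : set I) (b : I -> set T)
    (U : set T) (x : T) :
  (exists2 D', D' `<=` finI_from D b & \bigcup_(i in D') i = U) -> U x ->
  exists l : seq I, (forall i, List.In i l -> D i /\ b i x) /\
    forall y, (forall i, List.In i l -> b i y) -> U y.
Proof.
move=> [D' D'D <-] [S D'S Sx]; have [J JD JS] := D'D _ D'S.
have [l lJ] := finite_list (finite_fset J).
exists l; split=> [i /lJ iJ|y ly].
  by split; [exact/set_mem/JD|rewrite -JS in Sx; exact: Sx].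
by exists S => //; rewrite -JS => i iJ; apply: ly; exact/lJ.
Qed.

Lemma subbase_open (I : choiceType) (T : Type) (D : set I) (b : I -> set T) i :
  D i -> exists2 D', D' `<=` finI_from D b & \bigcup_(i in D') i = b i.
Proof.
move=> Di; exists [set b i]; first by move=> _ ->; exact: finI_from1.
by rewrite bigcup_set1.
Qed.

Section TypeSpace.
Variables (L : language) (C : structure L) (I : Type) (s : I -> Sort L).
Variable A : subfam C.

Lemma ctype_open (phi : pformula s A) : open [set q : ctype s A | ctype_set q phi].
Proof.
pose D := range (fun phi : pformula s A => [set q : ctype s A | ctype_set q phi]).
have Dphi : D [set q : ctype s A | ctype_set q phi] by exists phi.
exact: (@subbase_open _ _ D id _ Dphi).
Qed.

(** A basic open set is a finite intersection, hence is given by one formula. *)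
Lemma ctype_nbhd (U : set (ctype s A)) (x : stuple C s) : open U -> U (tp A x) ->
  exists Q, [/\ definable A Q, Q x & forall y, Q y -> U (tp A y)].
Proof.
move=> oU Ux; have [l [lD lU]] := subbase_nbhd oU Ux.
exists [set y : stuple C s | forall S, List.In S l -> S (tp A y)]; split.
- elim: l {lU} lD => [|S l IH] lD.
    have -> : [set y : stuple C s | forall S, List.In S [::] -> S (tp A y)] = setT.
      by apply/seteqP; split=> // y _ S [].
    exact: definableT.
  have -> : [set y : stuple C s | forall S', List.In S' (S :: l) -> S' (tp A y)] =
      [set y : stuple C s | S (tp A y)] `&` [set y : stuple C s | forall S', List.In S' l -> S' (tp A y)].
    apply/seteqP; split=> y.
      by move=> h; split=> [|S' Sl]; apply: h; [left|right].
    by move=> [h1 h2] S' [<- //|]; exact: h2.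
  apply: definableI; last by apply: IH => S' Sl; apply: lD; right.
  by have [[phi _ <-] _] := lD S (or_introl erefl); exists phi.
- by move=> S /lD[].
- by move=> y h; exact: lU.
Qed.

End TypeSpace.

Section SubVietoris.
Variable Z : topologicalType.

Lemma sub_vietoris_open (F : set Z) : closed F ->
  open ([set P : set Z | P `&` F = set0] : set (sub_vietoris Z)).
Proof.
move=> cF; exact: (@subbase_open _ _ (@closed Z) (fun F => [set P : set Z | P `&` F = set0]) _ cF).
Qed.

Lemma sub_vietoris_nbhd (V : set (sub_vietoris Z)) (P : set Z) : open V -> V P ->
  exists l : seq (set Z), (forall F, List.In F l -> closed F /\ P `&` F = set0) /\
    forall P' : set Z, (forall F, List.In F l -> P' `&` F = set0) -> V P'.
Proof. by move=> oV VP; have := subbase_nbhd oV VP. Qed.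

End SubVietoris.

Definition cylinder (eta : nat -> bool) (n : nat) : set (nat -> bool) :=
  [set eta' | forall i, (i < n)%N -> eta i = eta' i].

Lemma cylinder_nbhs (eta : cantor_space) n : nbhs eta (cylinder eta n : set cantor_space).
Proof.
elim: n => [|n IH]; first by apply: filterS filterT => eta' _ i.
have pn : nbhs eta [set eta' : cantor_space | eta n = eta' n].
  have := @proj_continuous nat (fun=> bool : topologicalType) n eta.
  move=> /(_ [set eta n] (discrete_set1 _)) h.
  by apply: filterS h => eta' <-.
apply: filterS (filterI IH pn) => eta' [h hn] i.
by rewrite ltnS leq_eqVlt => /orP[/eqP-> //|]; exact: h.
Qed.

(** The cylinders around [eta] generate a filter that converges to [eta] in each
    coordinate. *)
Lemma nbhs_cylinder (eta : cantor_space) (U : set cantor_space) :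
  nbhs eta U -> exists n, (cylinder eta n : set cantor_space) `<=` U.
Proof.
pose F : set_system cantor_space := filter_from [set: nat] (cylinder eta).
have FF : Filter F.
  apply: filter_from_filter; first by exists 0%N.
  move=> m n _ _; exists (maxn m n) => // eta' h.
  by split=> i im; apply: h; rewrite leq_max im ?orbT.
suff cF : F --> eta by move=> /cF[n _ h]; exists n.
apply/cvg_sup => i S /=; rewrite (@nbhsE (initial_topology (proj i : (nat -> bool) -> bool))) => -[B [[B' oB' <-] B'eta] BS].
exists i.+1 => // eta' h; apply: BS; rewrite /preimage /= /proj -h //.
Qed.

(** * The embedding of the Cantor space *)

Section Embedding.
Variables (L : language) (C : structure L) (K : Type).
Hypotheses (Kinf : embeds nat K) (satC : saturated K C).
Variables (I : Type) (s : I -> Sort L).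
Notation tup := (stuple C s).
Hypothesis IK : below K I.
Variables (A M : subfam C) (D : set tup).
Hypotheses (sA : small K (elements A)) (sM : small K (elements M)).
Hypothesis D_td : type_definable A D.

Notation Z := (set_type (@tp L C I s M @` D)).

Definition typeset (Q : set tup) : set Z :=
  [set q : Z | exists2 x, val q = tp M x & Q x].

Lemma Z_realised (q : Z) : exists2 x, D x & val q = tp M x.
Proof. by have [x Dx e] := set_valP q; exists x. Qed.

Lemma tp_definable (Q : set tup) x y :
  definable M Q -> tp M x = tp M y -> Q x -> Q y.
Proof.
move=> [phi ->] /(congr1 (fun q => ctype_set q phi)) /= e h.
by rewrite -e.
Qed.

Lemma typesetE Q (q : Z) x : definable M Q -> val q = tp M x ->
  typeset Q q <-> Q x.
Proof.
move=> dQ qx; split=> [[y qy]|Qx]; last by exists x.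
by apply: (tp_definable dQ); rewrite -qx.
Qed.

Lemma typeset_open Q : definable M Q -> open (typeset Q).
Proof.
move=> dQ; have [phi Qphi] := dQ.
exists [set q | ctype_set q phi]; first exact: ctype_open.
apply/seteqP; split=> q; have [x _ qx] := Z_realised q.
  move=> h; apply/(typesetE dQ qx); rewrite Qphi.
  by have : ctype_set (val q) phi := h; rewrite qx.
move=> /(typesetE dQ qx); rewrite Qphi => h.
by change (ctype_set (val q) phi); rewrite qx.
Qed.

Lemma typeset_setC Q : definable M Q -> ~` typeset Q = typeset (~` Q).
Proof.
move=> dQ; apply/seteqP; split=> q; have [x _ qx] := Z_realised q.
  by move=> nq; apply/(typesetE (definableC dQ) qx) => /(typesetE dQ qx).
by move=> /(typesetE (definableC dQ) qx) nQx /(typesetE dQ qx).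
Qed.

Lemma typeset_closed Q : definable M Q -> closed (typeset Q).
Proof.
move=> dQ; rewrite -[typeset Q]setCK; apply: open_closedC.
by rewrite typeset_setC //; apply: typeset_open; exact: definableC.
Qed.

Variable piece : (nat -> bool) -> nat -> set tup.
Hypothesis piece_def : forall eta n, definable M (piece eta n).
Hypothesis piece_dec : forall eta n, piece eta n.+1 `<=` piece eta n.
Hypothesis piece_ne : forall eta n, D `&` piece eta n !=set0.
Hypothesis piece_agree : forall eta eta' n,
  (forall i, (i < n)%N -> eta i = eta' i) -> piece eta n = piece eta' n.
Hypothesis piece_disj : forall eta eta' n x, eta n <> eta' n ->
  D x -> piece eta n.+1 x -> piece eta' n.+1 x -> False.

Definition branch (eta : nat -> bool) : set Z := \bigcap_n typeset (piece eta n).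

Lemma branch_realised eta (q : Z) :
  branch eta q <-> exists x, [/\ D x, forall n, piece eta n x & val q = tp M x].
Proof.
have [y Dy qy] := Z_realised q; split=> [h|[x [Dx xn qx]] n _]; last first.
  by apply/(typesetE (piece_def _ _) qx).
by exists y; split=> // n; apply/(typesetE (piece_def _ _) qy); exact: h.
Qed.

(** Compactness of the space of types over [M] of points of [D]; it comes from
    saturation over the parameters of both [D] and [M]. *)
Lemma branch_compact eta (F : set Z) : closed F ->
  (forall n, F `&` typeset (piece eta n) !=set0) -> F `&` branch eta !=set0.
Proof.
move=> cF Fn; pose B : subfam C := fun t => @A t `|` @M t.
have sB : small K (elements B) by exact: smallU.
pose ext_F := [set x : tup | exists q : Z, val q = tp M x /\ F q].
pose G := filter_from [set: nat] (fun n => D `&` piece eta n `&` ext_F).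
have GF : ProperFilter G.
  apply: filter_from_proper => [|n _].
    apply: filter_from_filter; first by exists 0%N.
    move=> m n _ _; exists (maxn m n) => // x [[Dx xp] Fx].
    by split; split=> //; split=> //; apply: (decreasing_le (S := piece eta) (@piece_dec eta) _ xp); rewrite ?leq_maxl ?leq_maxr.
  have [q [Fq qn]] := Fn n; have [x Dx qx] := Z_realised q.
  exists x; split; last by exists q.
  by split=> //; apply/(typesetE (piece_def _ _) qx).
have [x xP] := tuple_saturation Kinf satC IK sB GF.
have Dx : D x.
  have /type_definableE[H [HA DH]] := D_td.
  rewrite DH => S HS; apply: xP.
    by apply: definableS (HA _ HS) => t y; left.
  by exists 0%N => // y [[Dy _] _]; rewrite DH in Dy; exact: Dy.
have xp n : piece eta n x.
  apply: xP; last by exists n => // y [[]].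
  by apply: definableS (piece_def eta n) => t y; right.
have Zx : (@tp L C I s M @` D) (tp M x) by exists x.
pose q : Z := SigSub (mem_set Zx).
exists q; split; last by apply/branch_realised; exists x.
have [U oU UF] : open (~` F) by exact: closed_openC.
apply: contrapT => nFq.
have Ux : U (tp M x) by move: nFq; rewrite -[~ F q]/((~` F) q) -UF.
have [Q [dQ Qx QU]] := ctype_nbhd oU Ux.
have : (~` Q) x.
  apply: xP; first by apply: definableS (definableC dQ) => t y; right.
  exists 0%N => // y [_ [r [ry Fr]]] Qy.
  suff : (~` F) r by [].
  by rewrite -UF; change (U (val r)); rewrite ry; exact: QU.
exact.
Qed.

Lemma branch_ne eta : branch eta !=set0.
Proof.
have [|q [_ h]] := @branch_compact eta setT closedT; last by exists q.
move=> n; have [x [Dx xn]] := piece_ne eta n.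
have Zx : (@tp L C I s M @` D) (tp M x) by exists x.
by exists (SigSub (mem_set Zx)); split=> //; exists x.
Qed.

Lemma branch_closed eta : closed (branch eta).
Proof. by apply: closed_bigI => n _; exact: typeset_closed. Qed.

Lemma branch_Gdelta eta : Gdelta (branch eta).
Proof. by exists (fun n => typeset (piece eta n)) => // n; exact: typeset_open. Qed.

Lemma branch_disjoint eta eta' n q :
  eta n <> eta' n -> typeset (piece eta n.+1) q -> branch eta' q -> False.
Proof.
move=> en qn /branch_realised[x [Dx x' qx]].
have xn : piece eta n.+1 x by apply/(typesetE (piece_def _ _) qx).
exact: piece_disj en Dx xn (x' _).
Qed.

Lemma neq_branch (eta eta' : nat -> bool) : eta <> eta' -> exists n, eta n <> eta' n.
Proof.
move=> ne; apply: contrapT => nn; apply: ne; apply/funext => n.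
by apply: contrapT => en; apply: nn; exists n.
Qed.

Lemma branch_setI0 eta eta' : eta <> eta' -> branch eta `&` branch eta' = set0.
Proof.
move=> /neq_branch[n en]; apply/seteqP; split=> // q [qe qe'].
exact: (branch_disjoint en (qe n.+1 Logic.I) qe').
Qed.

(** Continuity is compactness: if [branch eta] misses a closed set then so does a
    piece of [eta] at a finite stage.  Conversely the branch of [eta'] is
    contained in the piece of [eta] at stage [n] exactly when [eta'] agrees with
    [eta] before [n], so the image of a cylinder is relatively open. *)
Lemma branch_embedding :
  homeo_embedding (branch : cantor_space -> sub_vietoris Z).
Proof.
split.
- move=> eta eta' e; apply: contrapT => /branch_setI0.
  rewrite -e setIid => e0; have [q] := branch_ne eta.
  by rewrite e0.
- apply/continuousP => V oV; rewrite openE => eta Veta.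
  have [l [lF lV]] := sub_vietoris_nbhd oV Veta.
  have [n nl] : exists n, forall F, List.In F l ->
      F `&` typeset (piece eta n) = set0.
    apply: list_bound => [F m n mn|F Fl].
      move=> h; apply/seteqP; split=> // q [Fq [x qx xn]].
      by rewrite -h; split=> //; exists x => //; exact: (decreasing_le (S := piece eta) (@piece_dec eta) mn xn).
    have [cF F0] := lF _ Fl; apply: contrapT => nF.
    have [|q [Fq qe]] := branch_compact (eta := eta) cF.
      move=> n; apply/set0P/eqP => h; apply: nF; by exists n.
    by have : set0 q by rewrite -F0.
  apply: filterS (cylinder_nbhs eta n) => eta' e; apply: lV => F Fl.
  apply/seteqP; split=> // q [qe' Fq]; rewrite -(nl _ Fl); split=> //.
  by rewrite (piece_agree e); exact: qe'.
- move=> U oU; pose J := [set en : cantor_space * nat |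
    (cylinder en.1 en.2 : set cantor_space) `<=` U].
  exists (\bigcup_(en in J) [set P : set Z | P `&` ~` typeset (piece en.1 en.2) = set0]).
    apply: bigcup_open => -[eta n] _; apply: sub_vietoris_open.
    by apply: open_closedC; exact: typeset_open.
  apply/seteqP; split=> [_ [eta Ueta <-]|P [[[eta n] /= h0 P0] [eta' _ e]]].
    split; last by exists eta.
    have [n nU] := nbhs_cylinder (open_nbhs_nbhs (conj oU Ueta)).
    exists (eta, n) => //=; apply/seteqP; split=> // q [qe nq].
    by apply: nq; exact: qe.
  rewrite -e in P0 *;   exists eta' => //; apply: h0 => i ni /=; apply: contrapT => ei.
  have [q qe'] := branch_ne eta'.
  have [x [Dx x' qx]] := iffLR (branch_realised _ _) qe'.
  have qn : typeset (piece eta n) q.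
    apply: contrapT => nq; have : set0 q by rewrite -P0; split.
    by [].
  apply: (branch_disjoint ei _ qe'); move: qn => [y qy yn]; exists y => //.
  exact: (decreasing_le (S := piece eta) (@piece_dec eta) ni yn).
Qed.

End Embedding.

(** * The model, and the action on its types *)

Lemma fixes_inverse (L : language) (C : structure L) (M : subfam C) (g : autom C) :
  fixes_setwise g M -> fixes_setwise (aut_inverse g) M.
Proof.
move=> gM t; rewrite -[in LHS](gM t) image_comp.
apply/seteqP; split=> [_ [x Mx <-]|x Mx]; first by rewrite /= aut_funK.
by exists x => //=; rewrite aut_funK.
Qed.

Lemma fixes_comp (L : language) (C : structure L) (M : subfam C) (g h : autom C) :
  fixes_setwise g M -> fixes_setwise h M -> fixes_setwise (aut_comp g h) M.
Proof. by move=> gM hM t; rewrite -[RHS](gM t) -[in RHS](hM t) -image_comp. Qed.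

Lemma realises_tp (L : language) (C : structure L) (I : Type) (s : I -> Sort L)
    (M : subfam C) (x u : stuple C s) (Q : set (stuple C s)) :
  realises u (ctype_set (tp M x)) -> definable M Q -> Q x -> Q u.
Proof. by move=> ux [phi ->]; exact: ux. Qed.

Lemma tp_class_type_definable (L : language) (C : structure L) (I : Type)
    (s : I -> Sort L) (a : stuple C s) : type_definable (@emptyp L C) (tp_class a).
Proof.
exists [set phi | sat (ptval a) phi]; apply/seteqP; split=> b.
  by move=> ab phi; apply: (iffLR (tp_empty_sat _ _)).
move=> ab; apply: ctype_inj; apply/seteqP; split=> phi /=; last exact: ab.
by move=> bphi; apply: contrapT => /(ab (Not phi)); exact.
Qed.

Lemma embeds_nat_sentence (L : language) : embeds nat (sentence L).
Proof.
pose f := fix f n : sentence L := if n is m.+1 then Imp Bot (f m) else Bot.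
by exists f; elim=> [|m IH] [|n] //= [/IH->].
Qed.

Lemma option_base (J U T : Type) (c : J -> option T) : embeds J U ->
  exists base : U -> option T, forall j x, c j = Some x -> exists u, base u = Some x.
Proof.
move=> [e ei].
exists (fun u => if pselect (exists j, e j = u) is left h then c (sval (cid h)) else None).
move=> j x cj; exists (e j); case: pselect => [h|[]]; last by exists j.
by rewrite (ei _ _ (svalP (cid h))).
Qed.

(** The upper bound on the cardinality is that of the Loewenheim-Skolem theorem.
    For the lower bound, an infinite sort has at least [K] points by saturation,
    and enough of them are put into the hull. *)
Lemma exists_model (L : language) (C : structure L) (K Lam : Type)
    (s : Lam -> Sort L) (th : nat -> set (stuple C s)) (ga : nat -> autom C) :
  saturated K C -> embeds nat K -> below K (sentence L + Lam) ->
  (forall n, definable (@allparam L C) (th n)) ->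
  exists M : substructure C, [/\ elementary M,
    elements M #<= [set: sentence L + Lam],
    (exists t : Sort L, infinite_set [set: C t]) ->
      elements M #= [set: sentence L + Lam],
    forall n, fixes_setwise (ga n) M & forall n, definable M (th n)].
Proof.
move=> satC Kinf sU th_def; set U := (sentence L + Lam)%type.
have LU : embeds (sentence L) U by exists inl => x y [].
have Uinf : embeds nat U := embeds_trans (embeds_nat_sentence L) LU.
have /choice[l lP] := fun n => definable_finite_param (th_def n).
pose pt := {t : Sort L & C t}.
have [c0 c0P] : exists c0 : U -> option pt, (exists t : Sort L, infinite_set [set: C t]) ->
    exists2 h : U -> pt, injective h & forall u, c0 u = Some (h u).
  have [[t tinf]|nt] := pselect (exists t : Sort L, infinite_set [set: C t]); last first.
    by exists (fun=> None).
  have [h hi] := embeds_trans sU.1 (infinite_sort_large Kinf satC tinf).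
  exists (fun u => Some (existT _ t (h u))) => _.
  by exists (fun u => existT _ t (h u)) => // u v e; exact: (hi _ _ (existT_inj e)).
pose c (j : nat * nat + U) : option pt := match j with
  | inl (n, i) => List.nth_error (l n) i | inr u => c0 u end.
have JU : embeds (nat * nat + U) U.
  apply: embeds_sum (embeds_refl U) => //.
  exact: embeds_prod.
have [base baseP] := option_base c JU.
have [M [Mel MU Mga Mbase]] := elementary_hull base ga Uinf LU.
exists M; split=> // [/c0P[h hi c0h]|n].
  have /andP : (elements M #<= [set: U]) && ([set: U] #<= elements M).
    apply/andP; split=> //; apply/card_leE.
    apply: embeds_trans (embeds_setT U).2 _.
    have hM u : elements M (h u).
      have [v bv] := baseP (inr u) _ (c0h u).
      by apply: (Mbase v); rewrite bv; case: (h u).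
    by exists (fun u => SigSub (mem_set (hM u))) => u v e; exact: (hi _ _ (congr1 val e)).
  by move=> /andP; rewrite card_eq_le.
apply: lP => t x /(@List.In_nth_error _ _ _)[i ix].
by have [u bu] := baseP (inl (n, i)) _ ix; exact: Mbase bu.
Qed.

Theorem theorem3p10 (L : language) (T : set (sentence L)) (K : Type)
    (C : structure L) (Lam : Type) (s : Lam -> Sort L)
    (X Y : set (stuple C s)) (E : stuple C s -> stuple C s -> Prop)
    (a : stuple C s) (Gam : set (autom C)) :
  complete_theory T -> has_infinite_models T ->
  monster_model K T C -> small K [set: Lam] ->
  type_definable (@emptyp L C) X ->
  equivalence_on X E -> Fsigma_rel E -> bounded K X E -> orbital_on_types X E ->
  Y `<=` X -> rel_saturated E Y -> pseudo_closed K Y ->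
  Y a ->
  (exists2 Phi, normal_form X E Phi & diameter (nf_dist Phi) (E a) = +oo%E) ->
  orbital_by Gam (tp_class a) (restr E (tp_class a)) ->
  exists M : substructure C,
    [/\ elementary M,
        elements M #<= [set: sentence L + Lam],
        (exists t : Sort L, infinite_set [set: C t]) ->
          elements M #= [set: sentence L + Lam]
      & exists phi : cantor_space ->
                     sub_vietoris (set_type (tp M @` (Y `&` tp_class a))),
          homeo_embedding phi /\
          forall eta eta' : cantor_space,
            let P : set (tp M @` (Y `&` tp_class a)) := phi eta in
            let P' : set (tp M @` (Y `&` tp_class a)) := phi eta' in
            let Q : set (ctype s M) := set_val @` P in
            let Q' : set (ctype s M) := set_val @` P' in
            [/\ [/\ P !=set0, closed P & Gdelta P],
                E0 eta eta' ->
                  (exists g : autom C, Gam g /\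
                     exists gM : fixes_setwise g M, type_act gM @` Q = Q') /\
                  type_saturation X E Q = type_saturation X E Q',
                eta <> eta' -> P `&` P' = set0
              & ~ E0 eta eta' ->
                  forall p q, Q p -> Q' q -> ~ type_rel E p q]].
Proof.
move=> _ _ [_ sT satC homC] sLam Xtd eqE [invE _] bddE [Etp _] YX Ysat.
move=> [A sA Ytd] Ya [Phi nfE diam] [GamG Gam_stable Gam_trans].
have [EX Erefl Esym Etrans] := eqE.
have bT : below K (sentence L) by apply/smallTE.
have bLam : below K Lam by apply/smallTE.
have Kinf : embeds nat K := embeds_trans (embeds_nat_sentence L) bT.1.
have sU := below_sum Kinf bT bLam.
pose P := tp_class a; pose D := Y `&` P.
have Ptd : type_definable (@emptyp L C) P := tp_class_type_definable a.
have Dtd : type_definable A D.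
  by apply: type_definableI => //; apply: type_definableS Ptd => t x [].
have Da : D a by split.
have Xa : X a := YX a Ya.
have EP x y : P x -> E x y -> P y by move=> Px /Etp xy; rewrite /P /tp_class /= -xy.
have PX x : P x -> X x.
  have /type_definableE[F [Fdef XF]] := Xtd.
  move=> xa; rewrite XF => S FS; have [phi Sphi] := Fdef S FS; rewrite Sphi.
  by apply/(tp_empty_sat phi xa); move: Xa; rewrite XF => /(_ S FS); rewrite Sphi.
have Gam_E g x : Gam g -> P x -> E x (aut_tuple g x).
  move=> Gg Px; have Rx : restr E P x x by split=> //; exact/Erefl/PX.
  have : (aut_tuple g @` restr E P x) (aut_tuple g x) by exists x.
  by rewrite Gam_stable // => -[].
have D_E x y : D x -> E x y -> D y.
  by move=> [Yx Px] Exy; split; [exact: Ysat Exy|exact: EP Exy].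
have D_inf x n : D x -> exists g, Gam g /\ ~ close Phi n x (aut_tuple g x).
  move=> [Yx Px]; have [y [z [Ey Ez yz]]] := infinite_diameter nfE (n + n) diam.
  have [h ha] := tp_homogeneous homC bLam Px.
  apply: contrapT => ng; apply: yz; apply/(close_aut _ h).
  have cl w : E a w -> close Phi n x (aut_tuple h w).
    move=> /(invE h); rewrite ha => Ew.
    have [|g Gg <-] := Gam_trans x (aut_tuple h w); first by split=> //; exact: EP Ew.
    by apply: contrapT => ncl; apply: ng; exists g.
  by apply: (close_trans nfE) (cl z Ez); apply: (close_sym nfE); exact: cl.
have [p [pU pD step]] := construction_step Kinf satC bLam eqE nfE bddE sA Dtd
  (ex_intro _ a Da) (fun x => PX x \o @proj2 _ _) D_E GamG
  (fun g x Gg Dx => Gam_E g x Gg Dx.2) D_inf.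
have [ga [th [Gga pth thdef [thS thga thsep]]]] := tree_exists GamG _ step.
have [M [Mel MU Mcard Mga Mth]] := exists_model ga satC Kinf sU thdef.
exists M; split=> //.
have sM : small K (elements M).
  apply/smallE; apply: below_embeds sU.
  exact: embeds_trans (iffLR (card_leE _ _) MU) (embeds_setT _).2.
have gaM eta n := path_fixes eta n Mga.
pose pc := piece ga th.
have pc_def eta n : definable M (pc eta n).
  apply: definable_aut (Mth n) => t x Mx.
  by rewrite /= -[M t](gaM eta n t); exists x.
have pc_dec : forall eta n, pc eta n.+1 `<=` pc eta n := piece_dec thS thga.
have pc_agree := @piece_agree _ _ _ s ga th.
have pc_sep := piece_sep nfE thsep.
have path_Gam eta n := path_group eta n GamG Gga.
have pc_ne eta n : D `&` pc eta n !=set0.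
  have [x [Dx thx]] := filter_ex (filterI pD (pth n)).
  have Gg := path_Gam eta n.
  exists (aut_tuple (path ga eta n) x); split; last by apply/pieceP; exists x.
  exact: (D_E _ _ Dx (Gam_E _ _ Gg Dx.2)).
have pc_disj eta eta' n x : eta n <> eta' n ->
    D x -> pc eta n.+1 x -> pc eta' n.+1 x -> False.
  move=> en [_ Px] xe xe'; apply: (pc_sep _ _ _ _ _ en xe xe').
  by apply: (close_le nfE (leq0n n)); apply: (close_refl nfE); exact: PX.
exists (@branch L C Lam s M D pc); split.
  exact: (branch_embedding Kinf satC bLam sA sM Dtd pc_def pc_dec pc_ne pc_agree pc_disj).
have memE e q : (set_val @` @branch L C Lam s M D pc e) q <->
    exists x, [/\ D x, forall n, pc e n x & q = tp M x].
  split=> [[r re <-]|[x [Dx xn ->]]].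
    by have [x [Dx xn rx]] := iffLR (branch_realised pc_def _ _) re; exists x.
  have Zx : (@tp L C Lam s M @` D) (tp M x) by exists x.
  exists (SigSub (mem_set Zx)) => //.
  by apply/(branch_realised pc_def); exists x.
move=> eta eta' /=.
have act_image (g : autom C) (gM : fixes_setwise g M) e e' :
    (forall x, D x -> (forall n, pc e n x) ->
       D (aut_tuple g x) /\ forall n, pc e' n (aut_tuple g x)) ->
    type_act gM @` (set_val @` @branch L C Lam s M D pc e) `<=` set_val @` @branch L C Lam s M D pc e'.
  move=> shift _ [_ /memE[x [Dx xn ->]] <-]; apply/memE.
  by exists (aut_tuple g x); rewrite act_tp; have [] := shift x Dx xn.
have act_saturation e e' : (exists g, Gam g /\ exists gM : fixes_setwise g M,
      type_act gM @` (set_val @` @branch L C Lam s M D pc e) = set_val @` @branch L C Lam s M D pc e') ->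
    type_saturation X E (set_val @` @branch L C Lam s M D pc e) `<=`
    type_saturation X E (set_val @` @branch L C Lam s M D pc e').
  move=> [g [Gg [gM gee']]] q [Xq [r re [u [v [ur vq Euv]]]]].
  split=> //; exists (type_act gM r); first by rewrite -gee'; exists r.
  exists (aut_tuple g u), v; split=> //.
    by move=> phi /ur /(sat_par_inv gM).
  have [x [[_ Px] _ rx]] := iffLR (memE e r) re; rewrite rx in ur.
  (* [D] need not be invariant over [M], so [u] may lie outside of [D]; it has
     the type of [a], which suffices for [Gam] to move it inside its class. *)
  have Pu : P u.
    have /type_definableE[F [Fdef PF]] := Ptd; rewrite PF => S FS.
    apply: (realises_tp ur); last by move: Px; rewrite PF; apply.
    by apply: definableS (Fdef S FS) => t y [].
  by apply: Etrans Euv; apply: Esym; exact: Gam_E.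
have orbit e e' : E0 e e' -> exists g, Gam g /\ exists gM : fixes_setwise g M,
    type_act gM @` (set_val @` @branch L C Lam s M D pc e) = set_val @` @branch L C Lam s M D pc e'.
  move=> [N eN]; pose g := aut_comp (path ga e' N) (aut_inverse (path ga e N)).
  pose g' := aut_comp (path ga e N) (aut_inverse (path ga e' N)).
  have [_ GM GV] := GamG.
  have Gg : Gam g by apply: GM; [exact: path_Gam|apply: GV; exact: path_Gam].
  have Gg' : Gam g' by apply: GM; [exact: path_Gam|apply: GV; exact: path_Gam].
  have gM : fixes_setwise g M by apply: fixes_comp; [|apply: fixes_inverse]; exact: gaM.
  have D_Gam h x : Gam h -> D x -> D (aut_tuple h x).
    by move=> Gh Dx; exact: (D_E _ _ Dx (Gam_E h x Gh Dx.2)).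
  exists g; split=> //; exists gM; apply/seteqP; split.
    apply: act_image => x Dx xn; split; first exact: D_Gam.
    exact: (piece_tail thS thga eN xn).
  move=> _ /memE[x [Dx xn ->]]; exists (tp M (aut_tuple g' x)).
    apply/memE; exists (aut_tuple g' x); split=> //; first exact: D_Gam.
    by apply: (piece_tail thS thga _ xn) => i Ni; rewrite eN.
  rewrite act_tp; congr tp.
  rewrite -[LHS]/(aut_tuple (path ga e' N) (aut_tuple (aut_inverse (path ga e N))
    (aut_tuple (path ga e N) (aut_tuple (aut_inverse (path ga e' N)) x)))).
  by rewrite aut_tupleK aut_tupleVK.
split.
- split.
  + exact: (branch_ne Kinf satC bLam sA sM Dtd pc_def pc_dec pc_ne).
  + exact: branch_closed.
  + exact: branch_Gdelta.
- move=> ee'; have ee : E0 eta' eta by have [N eN] := ee'; exists N => i /eN.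
  split; first exact: orbit.
  by apply/seteqP; split; apply: act_saturation; exact: orbit.
- exact: (branch_setI0 pc_def pc_disj).
- move=> nE0 q r /memE[x [Dx xn ->]] /memE[y [Dy yn ->]] [u [v [ux vy Euv]]].
  have [n uv] := E_close eqE nfE Euv; apply: nE0; exists n => m nm.
  apply: contrapT => em; apply: (pc_sep _ _ _ _ _ em).
  + exact: realises_tp ux (pc_def _ _) (xn m.+1).
  + exact: realises_tp vy (pc_def _ _) (yn m.+1).
  + exact: (close_le nfE nm).
Qed.
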